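(* Let $a<b$, $0<\alpha,\beta<1$, $l\in\mathbb R$, and let $L,g:[a,b]\times\mathbb R^3\to\mathbb R$ be of class $C^1$. Suppose that, for some constant $\lambda\in\mathbb R$, the functions $L(\underline x,y,u,v)$ and $\lambda g(\underline x,y,u,v)$ are convex in $[a,b]\times\mathbb R^3$, and let $F=L+\lambda g$. Let $y_0\in{}_a^{\alpha}E_b^{\beta}$ be such that $\partial_3L[y_0]$ and $\partial_3g[y_0]$ have continuous right Riemann--Liouville derivatives of order $\alpha$ and $\partial_4L[y_0]$ and $\partial_4g[y_0]$ have continuous left Riemann--Liouville derivatives of order $\beta$ on $[a,b]$. Suppose that $y_0$ is a solution of the fractional equation $$\partial_2 F[y_0](x)+{}_xD_b^\alpha\,\partial_3 F[y_0](x)+{}_aD_x^\beta\,\partial_4 F[y_0](x)=0,\qquad x\in[a,b],$$ and that $\int_a^b g[y_0](x)\,dx=l$. Then $y_0$ minimizes $$J(y)=\int_a^b L[y](x)\,dx$$ over all $y\in{}_a^{\alpha}E_b^{\beta}$ satisfying the constraints $y(a)=y_0(a)$, $y(b)=y_0(b)$ and $$I(y)=\int_a^b g[y](x)\,dx=l.$$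
   Context: Fractional operators. Let $0<\gamma<1$ and let $\Gamma$ be the Euler gamma function. The left and right Riemann--Liouville derivatives of order $\gamma$ are $${}_aD_x^\gamma f(x)=\frac{1}{\Gamma(1-\gamma)}\frac{d}{dx}\int_a^x (x-t)^{-\gamma}f(t)\,dt,\qquad {}_xD_b^\gamma f(x)=\frac{-1}{\Gamma(1-\gamma)}\frac{d}{dx}\int_x^b (t-x)^{-\gamma}f(t)\,dt$$ (one-sided derivatives at endpoints). The left and right Caputo derivatives are, for absolutely continuous $f:[a,b]\to\mathbb R$, $${}_a^CD_x^\gamma f(x)=\frac{1}{\Gamma(1-\gamma)}\int_a^x (x-t)^{-\gamma}f'(t)\,dt,\qquad {}_x^CD_b^\gamma f(x)=\frac{-1}{\Gamma(1-\gamma)}\int_x^b (t-x)^{-\gamma}f'(t)\,dt,$$ with the value at $x=a$ (left) or $x=b$ (right) understood as the limit. Function space: ${}_a^{\alpha}E_b^{\beta}$ is the set of $y:[a,b]\to\mathbb R$ for which ${}_a^CD_x^\alpha y$ and ${}_x^CD_b^\beta y$ exist and are continuous on $[a,b]$. Notation: $[y](x)=(x,y(x),{}_a^CD_x^\alpha y(x),{}_x^CD_b^\beta y(x))$; $L[y](x)=L([y](x))$ and similarly for $g$, $F$; $\partial_i$ is the partial derivative with respect to the $i$-th variable of a function of $(x,y,u,v)$. Convexity: $f(\underline x,y,u,v)$ is convex in $S\subseteq\mathbb R^4$ if $\partial_2 f,\partial_3 f,\partial_4 f$ exist and are continuous and $$f(x,y+y_1,u+u_1,v+v_1)-f(x,y,u,v)\ge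 \partial_2 f(x,y,u,v)\,y_1+\partial_3 f(x,y,u,v)\,u_1+\partial_4 f(x,y,u,v)\,v_1$$ for every $(x,y,u,v),(x,y+y_1,u+u_1,v+v_1)\in S$. *)

(* Defs.v *)
From HB Require Import structures.
From mathcomp Require Import all_boot all_order all_algebra.
From mathcomp Require Import all_classical all_reals all_analysis.

Set Implicit Arguments.
Unset Strict Implicit.
Unset Printing Implicit Defensive.

Import Order.TTheory GRing.Theory Num.Theory.
Import numFieldNormedType.Exports.

Local Open Scope classical_set_scope.
Local Open Scope ring_scope.

(* Functions on [a, b] (resp. on [a, b] x R^3) are represented by total
   functions on R (resp. on R^4).  The notions below, at points of [a, b]
   (resp. [a, b] x R^3), do not depend on the values outside of it. *)

Definition Gamma (R : realType) (s : R) : R :=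
  \int[lebesgue_measure]_(t in `]0, +oo[) (t `^ (s - 1) * expR (- t)).

(* Derivative relative to a set A: for A = [a, b] this is the usual derivative
   at interior points and the one-sided derivative at a and b. *)
Definition diff_quot (R : realType) (f : R -> R) (x z : R) : R :=
  (f z - f x) / (z - x).

Definition derivable_within (R : realType) (A : set R) (f : R -> R) (x : R) :
    Prop :=
  cvg (diff_quot f x z @[z --> within A x^']).

Definition derive_within (R : realType) (A : set R) (f : R -> R) (x : R) : R :=
  lim (diff_quot f x z @[z --> within A x^']).

Definition abs_continuous (R : realType) (a b : R) (f : R -> R) : Prop :=
  forall e : R, 0 < e -> exists2 d : R, 0 < d &
    forall (n : nat) (s t : 'I_n -> R),
      (forall i, a <= s i /\ s i <= t i /\ t i <= b) ->
      trivIset setT (fun i => [set` `]s i, t i[ ]) ->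
      \sum_(i < n) (t i - s i) < d ->
      \sum_(i < n) `|f (t i) - f (s i)| < e.

Section FractionalOperators.
Variable R : realType.
Implicit Types (a b gam x t : R) (f y : R -> R).
Local Notation mu := (@lebesgue_measure R).

Definition left_kernel gam f x t : R := (x - t) `^ (- gam) * f t.
Definition right_kernel gam f x t : R := (t - x) `^ (- gam) * f t.

Definition RL_left a b gam f x : R :=
  (Gamma (1 - gam))^-1 *
  derive_within `[a, b]
    (fun z => \int[mu]_(t in `]a, z[) left_kernel gam f z t) x.

Definition RL_right a b gam f x : R :=
  - (Gamma (1 - gam))^-1 *
  derive_within `[a, b]
    (fun z => \int[mu]_(t in `]z, b[) right_kernel gam f z t) x.

Definition has_continuous_RL_left a b gam f : Prop :=
  [/\ forall x, x \in `[a, b] ->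
        mu.-integrable `]a, x[ (EFin \o left_kernel gam f x),
      forall x, x \in `[a, b] ->
        derivable_within `[a, b]
          (fun z => \int[mu]_(t in `]a, z[) left_kernel gam f z t) x
    & {within `[a, b], continuous (RL_left a b gam f)}].

Definition has_continuous_RL_right a b gam f : Prop :=
  [/\ forall x, x \in `[a, b] ->
        mu.-integrable `]x, b[ (EFin \o right_kernel gam f x),
      forall x, x \in `[a, b] ->
        derivable_within `[a, b]
          (fun z => \int[mu]_(t in `]z, b[) right_kernel gam f z t) x
    & {within `[a, b], continuous (RL_right a b gam f)}].

(* An absolutely continuous f is differentiable almost everywhere; the junk
   value of derive1 f elsewhere does not affect the integrals. *)
Definition caputo_left_integral a gam f x : R :=
  (Gamma (1 - gam))^-1 *
  \int[mu]_(t in `]a, x[) left_kernel gam (derive1 f) x t.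

Definition caputo_right_integral b gam f x : R :=
  - (Gamma (1 - gam))^-1 *
  \int[mu]_(t in `]x, b[) right_kernel gam (derive1 f) x t.

Definition caputo_left a gam f x : R :=
  if x == a then lim (caputo_left_integral a gam f z @[z --> a^'+])
  else caputo_left_integral a gam f x.

Definition caputo_right b gam f x : R :=
  if x == b then lim (caputo_right_integral b gam f z @[z --> b^'-])
  else caputo_right_integral b gam f x.

(* Continuity on the closed interval forces the limits defining the values of
   the Caputo derivatives at the end points to exist. *)
Definition frac_space a b alpha beta : set (R -> R) :=
  [set y | [/\ abs_continuous a b y,
    forall x, x \in `]a, b] ->
      mu.-integrable `]a, x[ (EFin \o left_kernel alpha (derive1 y) x),
    forall x, x \in `[a, b[ ->
      mu.-integrable `]x, b[ (EFin \o right_kernel beta (derive1 y) x),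
    {within `[a, b], continuous (caputo_left a alpha y)}
  & {within `[a, b], continuous (caputo_right b beta y)}]].

Definition jet a b alpha beta y x : R * R * R * R :=
  (x, y x, caputo_left a alpha y x, caputo_right b beta y x).

End FractionalOperators.

Section FourVariables.
Variable R : realType.
Implicit Types (a b : R) (f : R * R * R * R -> R) (S : set (R * R * R * R)).

Definition slab a b : set (R * R * R * R) := [set p | p.1.1.1 \in `[a, b]].

Definition slice1 f (p : R * R * R * R) : R -> R :=
  let: (x, y, u, v) := p in fun s => f (s, y, u, v).
Definition slice2 f (p : R * R * R * R) : R -> R :=
  let: (x, y, u, v) := p in fun s => f (x, s, u, v).
Definition slice3 f (p : R * R * R * R) : R -> R :=
  let: (x, y, u, v) := p in fun s => f (x, y, s, v).
Definition slice4 f (p : R * R * R * R) : R -> R :=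
  let: (x, y, u, v) := p in fun s => f (x, y, u, s).

Definition partial1 a b f (p : R * R * R * R) : R :=
  derive_within `[a, b] (slice1 f p) p.1.1.1.
Definition partial2 f (p : R * R * R * R) : R := derive1 (slice2 f p) p.1.1.2.
Definition partial3 f (p : R * R * R * R) : R := derive1 (slice3 f p) p.1.2.
Definition partial4 f (p : R * R * R * R) : R := derive1 (slice4 f p) p.2.

Definition has_continuous_partials234 S f : Prop :=
  [/\ forall p, S p -> [/\ derivable (slice2 f p) p.1.1.2 1,
                           derivable (slice3 f p) p.1.2 1
                         & derivable (slice4 f p) p.2 1],
      {within S, continuous (partial2 f)},
      {within S, continuous (partial3 f)}
    & {within S, continuous (partial4 f)}].

(* Class C^1 on [a, b] x R^3 (one-sided first partial derivative on the
   boundary). *)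
Definition C1_slab a b f : Prop :=
  [/\ {within slab a b, continuous f},
      forall p, slab a b p -> derivable_within `[a, b] (slice1 f p) p.1.1.1,
      {within slab a b, continuous (partial1 a b f)}
    & has_continuous_partials234 (slab a b) f].

Definition convex_in S f : Prop :=
  has_continuous_partials234 S f /\
  forall x y u v y1 u1 v1 : R,
    S (x, y, u, v) -> S (x, y + y1, u + u1, v + v1) ->
    partial2 f (x, y, u, v) * y1 + partial3 f (x, y, u, v) * u1
      + partial4 f (x, y, u, v) * v1
    <= f (x, y + y1, u + u1, v + v1) - f (x, y, u, v).

End FourVariables.

Definition minimizes (R : realType) (T : Type) (J : T -> R) (A : set T)
    (y0 : T) : Prop :=
  A y0 /\ forall y, A y -> J y0 <= J y.

(* Main.v *)
(* By convexity, for F = L + lambda g,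
     F[y] - F[y0] >= d2F[y0] h + d3F[y0] D^alpha h + d4F[y0] D^beta h,  h = y - y0,
   and I(y) = I(y0), so it suffices that the integral of the right-hand side
   vanishes.  This follows from the Euler-Lagrange equation once fractional
   integration by parts moves the Caputo derivatives of h onto the
   Riemann-Liouville derivatives of d3F[y0] and d4F[y0].  With
   Phi(t) = \int_t^b (x - t)^-alpha f(x) dx, the integral of f D^alpha y is, by
   Fubini on the triangle a < t < x < b, that of y' Phi up to the factor
   1 / Gamma(1 - alpha); as y is only absolutely continuous, integrating y' Phi
   by parts is a second Fubini argument, based on y(x) - y(a) = \int_a^x y'.
   That formula is obtained by writing y as the difference of two nondecreasing
   absolutely continuous functions (the total variation of y and what remains),
   whose Stieltjes measures have a density by Radon-Nikodym; Lebesgue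
   differentiation identifies this density with y' almost everywhere. *)

Require Import Defs.
From HB Require Import structures.
From mathcomp Require Import all_boot all_order all_algebra.
From mathcomp Require Import all_classical all_reals all_analysis.
From mathcomp Require Import measurable_realfun ring lra.

Import Order.TTheory GRing.Theory Num.Theory.
Import numFieldNormedType.Exports.

Local Open Scope classical_set_scope.
Local Open Scope ring_scope.

Set Implicit Arguments.
Unset Strict Implicit.
Unset Printing Implicit Defensive.

(** * Absolute continuity and total variation *)

Section AbsoluteContinuity.
Variable R : realType.
Implicit Types (a b s t : R) (f : R -> R) (p q : R * R) (l : seq (R * R)).

(** A list of pairs stands for a family of intervals, so that intervals can be cut and regrouped by
    concatenation. For nondegenerate intervals the relation means that the interiors are disjoint;
    it also forbids a degenerate interval from lying inside another one. *)
Definition separated p q := (p.2 <= q.1) || (q.2 <= p.1).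

Definition inside a b p := [&& a <= p.1, p.1 <= p.2 & p.2 <= b].

Definition increments f l := \sum_(p <- l) `|f p.2 - f p.1|.

Definition total_length l := \sum_(p <- l) (p.2 - p.1).

Definition small_increments a b f (d e : R) := forall l,
  all (inside a b) l -> pairwise separated l -> total_length l < d ->
  increments f l < e.

Definition seq_abs_continuous a b f :=
  forall e : R, 0 < e -> exists2 d, 0 < d & small_increments a b f d e.

Lemma separated_sym p q : separated p q = separated q p.
Proof. by rewrite /separated orbC. Qed.

Lemma separated_inside p q q' : separated p q -> inside q.1 q.2 q' ->
  separated p q'.
Proof.
move=> + /and3P[h1 h2 h3]; rewrite /separated => /orP[] h; apply/orP.
  by left; rewrite (le_trans h).
by right; rewrite (le_trans _ h).
Qed.

(** Separated intervals have disjoint interiors, so [abs_continuous] applies to the family indexed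
    by positions in the list. *)
Lemma abs_continuous_seq a b f : abs_continuous a b f ->
  seq_abs_continuous a b f.
Proof.
move=> acf e e0; have [d d0 acd] := acf e e0; exists d => // l lab lsep ld.
have := acd (size l) (fun i => (nth (0, 0) l i).1)
  (fun i => (nth (0, 0) l i).2).
have sumE (F : R * R -> R) :
    \sum_(p <- l) F p = \sum_(i < size l) F (nth (0, 0) l i).
  by rewrite (big_nth (0, 0)) big_mkord.
rewrite /increments sumE; apply.
- move=> i; have /(allP lab)/and3P[] := mem_nth (0, 0) (ltn_ord i) => //.
- move=> i j _ _ [x []] /=; rewrite !in_itv/= => /andP[ix xi] /andP[jx xj].
  apply: ord_inj; apply/eqP; rewrite eqn_leq (leqNgt i) (leqNgt j).
  (* [pairwise] relates an entry only to later ones, so the indices are compared in order. *)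
  have nsep (k m : nat) : (k < m)%N -> (m < size l)%N ->
      (nth (0, 0) l k).1 < x -> x < (nth (0, 0) l k).2 ->
      (nth (0, 0) l m).1 < x -> x < (nth (0, 0) l m).2 -> False.
    move=> km ml h1 h2 h3 h4.
    have /(pairwiseP (0, 0)) := lsep => /(_ k m).
    rewrite !inE (ltn_trans km ml) => /(_ isT ml km) /orP[]; apply/negP.
      by rewrite -ltNge (lt_trans h3).
    by rewrite -ltNge (lt_trans h1).
  apply/andP; split; apply/negP => h.
    exact: (nsep _ _ h (ltn_ord _) jx xj ix xi).
  exact: (nsep _ _ h (ltn_ord _) ix xi jx xj).
- by rewrite -(sumE (fun p => p.2 - p.1)).
Qed.

(** A partition omits its starting point; zipping [s :: r] with [r] lists its consecutive intervals.
    This is what allows one interval of a list to be replaced by the intervals of a partition of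
    it. *)
Lemma partition_pairs s t r : itv_partition s t r ->
  [/\ all (inside s t) (zip (s :: r) r), pairwise separated (zip (s :: r) r),
      total_length (zip (s :: r) r) = t - s &
      forall f, increments f (zip (s :: r) r) = variation s t f r].
Proof.
move=> srt; suff [i1 i2 i3] : [/\ all (inside s t) (zip (s :: r) r),
    pairwise separated (zip (s :: r) r) &
    total_length (zip (s :: r) r) = t - s].
  split => // f; rewrite variation_zip// /increments.
  elim: r s {srt i1 i2 i3} => [|x r ih] s /=; first by rewrite !big_nil.
  by rewrite !big_cons/= ih.
elim: r s srt => [s /itv_partition_nil -> //=|x r ih s].
  by rewrite /total_length big_nil subrr.
move=> sxt; have /ih[i1 i2 i3] := itv_partition_cons sxt.
have xt := itv_partition_le (itv_partition_cons sxt).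
have sx : s < x by case: sxt => /= /andP[].
rewrite /total_length big_cons/= in i3 *; split.
- rewrite /inside/= lexx (ltW sx) xt/=; apply: sub_all i1 => p.
  by case/and3P => h1 h2 h3; rewrite /inside (le_trans (ltW sx) h1) h2.
- rewrite i2 andbT; apply: sub_all i1 => p /and3P[h1 _ _].
  by rewrite /separated/= h1.
- by rewrite i3; ring.
Qed.

(* The intervals of l are replaced one by one by the intervals of a partition of
   them, which move to m; then one takes the supremum over the partitions. *)
Lemma total_variation_le_small (f : R -> R) a b d e :
  small_increments a b f d e ->
  forall l m, all (inside a b) (l ++ m) -> pairwise separated (l ++ m) ->
  total_length (l ++ m) < d ->
  (\sum_(p <- l) total_variation p.1 p.2 f + (increments f m)%:E <= e%:E)%E.
Proof.
move=> small; elim=> [m|[s t] l ih m].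
  by rewrite big_nil add0e lee_fin => am sm dm; exact/ltW/small.
rewrite cat_cons => /= /andP[ist alm] /andP[slm plm].
rewrite /total_length !big_cons/= => dlm.
have st : s <= t by case/and3P: ist.
have part r : itv_partition s t r ->
    (\sum_(p <- l) total_variation p.1 p.2 f +
      (variation s t f r)%:E + (increments f m)%:E <= e%:E)%E.
  move=> /partition_pairs[ir sr lr <-].
  set P := zip _ _ in ir sr lr *.
  have -> : (\sum_(p <- l) total_variation p.1 p.2 f + (increments f P)%:E
      + (increments f m)%:E = \sum_(p <- l) total_variation p.1 p.2 f
      + (increments f (P ++ m))%:E)%E.
    by rewrite -addeA -EFinD /increments big_cat.
  apply: ih.
  - move: alm; rewrite !all_cat => /andP[-> ->]/=; rewrite andbT.
    apply: sub_all ir => p /and3P[/= h1 h2 h3].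
    case/and3P: ist => /= g1 g2 g3.
    by rewrite /inside (le_trans g1 h1) h2 (le_trans h3 g3).
  - move: plm slm; rewrite !pairwise_cat all_cat.
    move=> /and3P[lm pl pm] /andP[sl sm].
    rewrite pl pm sr/= !andbT allrel_catr lm andbT; apply/andP; split.
      apply/allrelP => p q pl' qP; apply: (@separated_inside _ (s, t)).
        by rewrite separated_sym (allP sl).
      exact: (allP ir).
    apply/allrelP => p q pP qm; rewrite separated_sym.
    apply: (@separated_inside _ (s, t)); first by rewrite separated_sym (allP sm).
    exact: (allP ir).
  - move: dlm; rewrite /total_length !big_cat/= -/(total_length P) lr.
    by lra.
(* Some partition is needed to see that [S] is finite and may be moved across the inequality; for s
   = t it is the empty list. *)
have [r0 r0st] : exists r, itv_partition s t r.
  move: st; rewrite le_eqVlt => /predU1P[->|st]; first by exists [::].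
  by exists [:: t]; exact: itv_partition1.
rewrite -addeA.
set S := (_ + (increments f m)%:E)%E.
have S0 : (0 <= S)%E.
  rewrite adde_ge0//; last by rewrite lee_fin sumr_ge0.
  rewrite big_seq; apply: sume_ge0 => p pl; apply: total_variation_ge0.
  move: alm; rewrite all_cat => /andP[/allP /(_ _ pl)] /and3P[] //.
have partS r : itv_partition s t r -> ((variation s t f r)%:E + S <= e%:E)%E.
  by move=> /part; rewrite -addeA addeCA.
have Sfin : S \is a fin_num.
  rewrite ge0_fin_numE//; apply: (@le_lt_trans _ _ e%:E); last exact: ltry.
  apply: le_trans (partS _ r0st); rewrite leeDr// lee_fin; exact: variation_ge0.
rewrite -leeBrDr//; apply: ge_ereal_sup => _ [_ [r rst <-] <-].
by rewrite leeBrDr//; exact: partS.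
Qed.

End AbsoluteContinuity.

Section Variation.
Variable R : realType.
Implicit Types (a b s t : R) (f : R -> R).

Lemma seq_abs_continuousB a b f g : seq_abs_continuous a b f ->
  seq_abs_continuous a b g -> seq_abs_continuous a b (f \- g).
Proof.
move=> acf acg e e0; have e20 : 0 < e / 2 by rewrite divr_gt0.
have [d d0 fd] := acf _ e20; have [d' d'0 gd] := acg _ e20.
exists (Num.min d d'); first by rewrite lt_min d0.
move=> l il sl; rewrite lt_min => /andP[ld ld'].
rewrite (splitr e); apply: le_lt_trans (ltrD (fd l il sl ld) (gd l il sl ld')).
rewrite /increments -big_split/=; apply: ler_sum => p _.
have -> : (f \- g) p.2 - (f \- g) p.1 = (f p.2 - f p.1) - (g p.2 - g p.1).
  by rewrite /=; ring.
exact: ler_normB.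
Qed.

(** With e = 1, the variation over any interval shorter than d is at most 1. Finitely many steps of
    length d / 2 cover [a, b], and variation is additive. *)
Lemma seq_abs_continuous_total_variation_fin a b f : a <= b ->
  seq_abs_continuous a b f -> total_variation a b f \is a fin_num.
Proof.
move=> ab acf; have [d d0 small] := acf 1 ltr01.
have short s t : a <= s -> s <= t -> t <= b -> t - s < d ->
    (total_variation s t f < +oo)%E.
  move=> sa st tb tsd; apply: (@le_lt_trans _ _ 1%E); last exact: ltry.
  have := @total_variation_le_small _ _ _ _ _ _ small [:: (s, t)] [::].
  rewrite /= /total_length /increments !big_cons !big_nil/= !addr0.
  by apply => //; rewrite /inside/= sa st tb.
have d20 : 0 < d / 2 by rewrite divr_gt0.
have step n x : a <= x -> x <= b -> x - a < n%:R * (d / 2) ->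
    (total_variation a x f < +oo)%E.
  elim: n x => [x ax _|n ih x ax xb xn].
    by rewrite mul0r subr_lt0 ltNge ax.
  have [xa|xa] := leP (x - d / 2) a.
    by apply: short => //; lra.
  rewrite (@total_variationD _ a x (x - d / 2)) ?(ltW xa)//; last by lra.
  apply: lte_add_pinfty.
    apply: ih; [exact: ltW|lra|]; move: xn; rewrite -natr1; lra.
  by apply: short; lra.
rewrite ge0_fin_numE; last exact: total_variation_ge0.
apply: (step (Num.bound ((b - a) / (d / 2)))) => //.
rewrite -ltr_pdivrMr//; apply: archi_boundP.
by rewrite divr_ge0 ?subr_ge0// ltW.
Qed.

Lemma seq_abs_continuousS a b s t f : a <= s -> t <= b ->
  seq_abs_continuous a b f -> seq_abs_continuous s t f.
Proof.
move=> as' tb acf e /acf[d d0 fd]; exists d => // l il; apply: fd.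
apply: sub_all il => p /and3P[h1 h2 h3].
by rewrite /inside (le_trans as' h1) h2 (le_trans h3 tb).
Qed.

Lemma total_variation_increment a b f s t : a <= s -> s <= t -> t <= b ->
  seq_abs_continuous a b f ->
  total_variation s t f =
    (fine (total_variation a t f) - fine (total_variation a s f))%:E.
Proof.
move=> sa st tb acf.
have sf : total_variation a s f \is a fin_num.
  apply: seq_abs_continuous_total_variation_fin => //.
  by apply: seq_abs_continuousS acf => //; exact: le_trans tb.
have tf : total_variation s t f \is a fin_num.
  apply: seq_abs_continuous_total_variation_fin => //.
  exact: seq_abs_continuousS acf.
rewrite (total_variationD _ sa st) fineD// EFinB EFinD !fineK//.
by rewrite addeAC subee// add0e.
Qed.

(** Increments of the variation function are variations over the intervals of the list, whose sum
    [total_variation_le_small] bounds. That bound is not strict, hence the choice of e / 2. *)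
Lemma seq_abs_continuous_variation a b f : seq_abs_continuous a b f ->
  seq_abs_continuous a b (fun x => fine (total_variation a x f)).
Proof.
move=> acf e e0; have [d d0 small] := acf _ (divr_gt0 e0 (ltr0n R 2)).
exists d => // l il sl ld.
have := @total_variation_le_small _ _ _ _ _ _ small l [::].
rewrite cats0 /increments big_nil adde0 => /(_ il sl ld) h.
suff : ((increments (fun x => fine (total_variation a x f)) l)%:E <=
    (e / 2)%:E)%E by rewrite lee_fin => /le_lt_trans; apply; lra.
apply: le_trans h; rewrite /increments -sumEFin big_seq [leRHS]big_seq.
apply: lee_sum => p pl; have /and3P[h1 h2 h3] := allP il _ pl.
rewrite (total_variation_increment h1 h2 h3 acf) lee_fin ger0_norm//.
by rewrite -lee_fin -(total_variation_increment h1 h2 h3 acf) total_variation_ge0.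
Qed.

End Variation.

(** * The fundamental theorem of calculus for absolutely continuous functions *)

(** Finite measure excludes infinite end points. The two inclusions serve different measures: the
    half-open interval bounds the Stieltjes measure of J from above, the open one bounds its length
    from below. *)
Lemma open_interval_endpoints (R : realType) (J : set R) :
  open J -> is_interval J -> (lebesgue_measure J < +oo)%E ->
  exists p : R * R, [/\ p.1 <= p.2, J `<=` `]p.1, p.2] & `]p.1, p.2[ `<=` J].
Proof.
move=> oJ /is_intervalP JE finJ.
have [J0|/set0P [z Jz]] := eqVneq J set0.
  exists (0, 0); split => //= [|x]; first by rewrite J0.
  by rewrite /= in_itv/= => /andP[/lt_trans h /h]; rewrite ltxx.
have nomin s : J s -> (forall x, J x -> s <= x) -> False.
  move=> Js Jle; have : nbhs s J by exact: open_nbhs_nbhs.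
  move=> /nbhs_ballP[e /= e0 sJ]; have /Jle : J (s - e / 2).
    by apply: sJ; rewrite /ball/= opprB addrCA subrr addr0 gtr0_norm; lra.
  by lra.
case E : (Rhull J) JE => [b1 b2] JE; move: finJ; rewrite JE lebesgue_measure_itv.
have /= zJ : z \in Interval b1 b2 by move: Jz; rewrite JE.
have b12 : (b1 < b2)%O.
  by move: zJ; rewrite itv_boundlr => /andP[/le_lt_trans]; apply; rewrite bnd_simp.
rewrite /=.
case: b1 b2 {E} JE zJ b12 => [x1 s|[]] [x2 t|[]] JE zJ b12 //=;
  rewrite ?ltry ?ltNyr//=.
move=> _.
have /andP[sz zt] : s <= z <= t.
  move: zJ; rewrite itv_boundlr; case: (x1); case: (x2); rewrite !bnd_simp;
    by move=> /andP[h1 h2]; apply/andP; split => //; exact: ltW.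
exists (s, t); split => /=.
- exact: le_trans zt.
- case: x1 JE zJ b12 => JE zJ b12; last first.
    by move=> x /=; apply: subset_itvl; rewrite bnd_simp; case: (x2).
  (* A closed left bound would be a minimum of the open set J. *)
  exfalso; apply: (nomin s).
    rewrite JE/= itv_boundlr lexx/=; move: zJ; rewrite itv_boundlr => /andP[_].
    by apply: le_trans; rewrite bnd_simp.
  by move=> x; rewrite JE/= itv_boundlr => /andP[].
- by apply: set_interval.subset_itv; rewrite bnd_simp; case: (x1); case: (x2).
Qed.

(** * Density of the Stieltjes measure of a nondecreasing absolutely continuous function *)

Section StieltjesDensity.
Variables (R : realType) (a b : R) (G : R -> R).
Hypothesis ab : a <= b.
Hypothesis ndG : {in `[a, b] &, nondecreasing_fun G}.
Hypothesis acG : seq_abs_continuous a b G.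
Local Notation mu := (@lebesgue_measure R).

(* G is extended to R by constants to define its Stieltjes measure. *)
Let clamp (x : R) : R := Num.max a (Num.min x b).

Let clamp_itv x : clamp x \in `[a, b].
Proof. by rewrite in_itv/= le_max lexx ge_max ab ge_min lexx orbT. Qed.

Let clamp_id x : x \in `[a, b] -> clamp x = x.
Proof.
by rewrite in_itv/= /clamp => /andP[ax xb]; rewrite min_l// max_r.
Qed.

Let clamp_le x y : x <= y -> clamp x <= clamp y.
Proof.
by move=> xy; rewrite /clamp le_max2 // le_min2.
Qed.

Let clamp_lip x y : x <= y -> clamp y - clamp x <= y - x.
Proof.
move=> xy; rewrite /clamp /Num.max /Num.min.
by case: ifPn => //; case: ifPn => //; case: ifPn => //; case: ifPn => //=; lra.
Qed.

Let Gx (x : R) : R := G (clamp x).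

Let Gx_nd : nondecreasing Gx.
Proof. by move=> x y xy; apply: ndG => //; exact: clamp_le. Qed.

(** Clamping is nondecreasing and 1-Lipschitz: it sends a separated list to a separated list inside
    [a, b] of no greater total length. *)
Let Gx_small e : 0 < e -> exists2 d : R, 0 < d & forall l : seq (R * R),
  all (fun p => p.1 <= p.2) l -> pairwise (@separated R) l ->
  total_length l < d -> \sum_(p <- l) (Gx p.2 - Gx p.1) < e.
Proof.
move=> e0; have [d d0 small] := acG e0; exists d => // l /allP il sl ld.
pose l' := [seq (clamp p.1, clamp p.2) | p <- l].
suff : increments G l' < e.
  rewrite /increments big_map; apply: le_lt_trans.
  rewrite big_seq [leRHS]big_seq; apply: ler_sum => p pl.
  exact: ler_norm.
apply: small.
- apply/allP => _ /mapP[p pl ->]; rewrite /inside/= (clamp_le (il _ pl))/=.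
  have := clamp_itv p.1; have := clamp_itv p.2.
  by rewrite !in_itv/= => /andP[_ ->] /andP[->].
- rewrite pairwise_map; apply: sub_pairwise sl => p q.
  by rewrite /separated/= => /orP[] /clamp_le ->//; rewrite orbT.
- apply: le_lt_trans ld; rewrite /total_length big_map big_seq [leRHS]big_seq.
  by apply: ler_sum => p /il pl; exact: clamp_lip.
Qed.

Let Gx_unif e : 0 < e -> exists2 d : R, 0 < d & forall x y, x <= y ->
  y - x < d -> Gx y - Gx x < e.
Proof.
move=> /Gx_small[d d0 h]; exists d => // x y xy xyd.
have := h [:: (x, y)]; rewrite /total_length !big_cons !big_nil/= !addr0 xy.
exact.
Qed.

Let Gx_rc : right_continuous Gx.
Proof.
move=> x; apply/cvgrPdist_lt => e e0; have [d d0 h] := Gx_unif e0.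
near=> y; have xy : x < y by [].
rewrite distrC ger0_norm ?subr_ge0 ?Gx_nd ?ltW//; apply: h; first exact: ltW.
rewrite ltrBlDl; near: y; apply: nbhs_right_lt; rewrite ltrDl//.
Unshelve. all: by end_near. Qed.

Lemma monotone_density : exists2 rho : R -> R,
  mu.-integrable setT (EFin \o rho) &
  forall x, x \in `[a, b] ->
    (G x - G a)%:E = (\int[mu]_(t in `]a, x]) (rho t)%:E)%E.
Proof.
pose Gc : cumulative R R := HB.pack Gx (isCumulative.Build _ _ _ Gx Gx_nd Gx_rc).
pose nu := lebesgue_stieltjes_measure Gc.
have nuE s t : s <= t -> nu `]s, t]%classic = (Gx t - Gx s)%:E.
  move=> st; rewrite /nu /lebesgue_stieltjes_measure /measure_extension.
  rewrite measurable_mu_extE/=; last exact: is_ocitv.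
  by rewrite wlength_itv_bnd.
(* The line is the increasing union of the intervals ]-n, n], each of mass at most G b - G a. *)
have nuT : (nu setT <= (G b - G a)%:E)%E.
  rewrite -(bigcup_itvT false false).
  pose F (n : nat) : set R := `]- n%:R, n%:R]%classic.
  have cv : nu \o F @ \oo --> nu (\bigcup_n F n).
    apply: nondecreasing_cvg_mu.
    - by move=> n; exact: measurable_itv.
    - by apply: bigcup_measurable => n _; exact: measurable_itv.
    - move=> m n mn; apply/subsetPset; apply: set_interval.subset_itv.
        by rewrite bnd_simp lerN2 ler_nat.
      by rewrite bnd_simp ler_nat.
  apply: (cvge_to_le cv); apply: nearW => n /=; rewrite nuE ?lee_fin.
    apply: lerB; apply: ndG => //; rewrite ?bound_itvE//.
      by have := clamp_itv n%:R; rewrite in_itv => /andP[].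
    by have := clamp_itv (- n%:R); rewrite in_itv => /andP[].
  by rewrite (@le_trans _ _ 0)// oppr_le0.
(* A null set lies in an open set U of length less than d. The components of U are disjoint
   intervals; any finitely many have total length less than d, hence Stieltjes mass less than e, and
   sigma-additivity extends the bound to U. *)
have numu : nu `<< mu.
  apply/null_content_dominatesP => A mA muA0.
  apply/eqP; rewrite eq_le measure_ge0 andbT; apply/lee_addgt0Pr => e e0.
  rewrite add0e; have [d d0 small] := Gx_small e0.
  have [|U [oU AU UAd]] := lebesgue_regularity_outer mA _ d0.
    by rewrite muA0.
  have mU : measurable U := open_measurable oU.
  have {UAd} Ud : (mu U < d%:E)%E.
    apply: le_lt_trans UAd; rewrite -[leRHS]add0e -[X in (X + _)%E]muA0.
    rewrite -[in leLHS](classical_sets.setDUK AU).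
    exact: (measureU2 _ mA (measurableD mU mA)).
  have [I [oI tI UE]] := OpenSetDisjointItvs.open_disjoint_itv oU.
  have mI k : measurable (I k) by apply: open_measurable; exact: (oI k).1.
  have finI k : (mu (I k) < +oo)%E.
    apply: (@le_lt_trans _ _ (mu U)); last exact: lt_trans Ud (ltry _).
    apply: le_measure; rewrite ?inE//; first exact: mI.
    by rewrite UE; exact: bigcup_sup.
  have /choice[p pE] k := open_interval_endpoints (oI k).1 (oI k).2 (finI k).
  apply: (@le_trans _ _ (nu U)); first by rewrite le_measure ?inE.
  rewrite UE.
  apply: (cvge_to_le (@measure_sigma_additive _ _ _ nu I mI tI)).
  apply: nearW => n.
  (* Degenerate intervals are dropped: disjointness does not make them [separated], and they add
     nothing to the mass. *)
  pose l := [seq p k | k <- iota 0 n & (p k).1 < (p k).2].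
  apply: (@le_trans _ _ (\sum_(q <- l) (Gx q.2 - Gx q.1))%:E).
    rewrite big_map big_filter -sumEFin [leRHS]big_mkcond /= /index_iota subn0.
    apply: lee_sum => k _; have [pk1 pk2 pk3] := pE k.
    apply: (@le_trans _ _ (Gx (p k).2 - Gx (p k).1)%:E).
      rewrite -nuE//; apply: le_measure; rewrite ?inE;
        [exact: mI|exact: measurable_itv|exact: pk2].
    case: ifPn => //; rewrite -leNgt => pk.
    by rewrite lee_fin subr_le0 Gx_nd.
  rewrite lee_fin ltW//; apply: small.
  - by apply/allP => _ /mapP[k _ ->]; have [] := pE k.
  - rewrite pairwise_map; apply/(pairwiseP 0%N) => i j.
    set s := [seq k <- iota 0 n | (p k).1 < (p k).2]; rewrite !inE => si sj ij.
    have us : uniq s by rewrite filter_uniq// iota_uniq.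
    have := mem_nth 0%N si; have := mem_nth 0%N sj.
    have : nth 0%N s i != nth 0%N s j by rewrite nth_uniq// ltn_eqF.
    rewrite /=; move: (nth _ s i) (nth _ s j) => {si sj ij us i j} i j ij.
    rewrite !mem_filter => /andP[pj _] /andP[pi _].
    have [_ _ Ii] := pE i; have [_ _ Ij] := pE j.
    rewrite /separated !leNgt -negb_and; apply/negP => /andP[h1 h2].
    have [z zi zj] : exists2 z, z \in `](p i).1, (p i).2[ &
        z \in `](p j).1, (p j).2[.
      (* The midpoint of the overlap would belong to two disjoint components. *)
      exists ((Num.max (p i).1 (p j).1 + Num.min (p i).2 (p j).2) / 2).
        by rewrite in_itv/=; rewrite /Num.max /Num.min; do 2 case: ifPn; lra.
      by rewrite in_itv/=; rewrite /Num.max /Num.min; do 2 case: ifPn; lra.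
    move/negP: ij; apply; apply/eqP; apply: (tI i j) => //.
    by exists z; split; [exact: Ii|exact: Ij].
  - rewrite -lte_fin; apply: le_lt_trans Ud.
    rewrite /total_length big_map big_filter -sumEFin.
    apply: (@le_trans _ _ (\sum_(0 <= k < n) mu (I k))%E).
      rewrite [leLHS]big_mkcond/= /index_iota subn0; apply: lee_sum => k _.
      case: ifPn => // pk; have [pk1 pk2 pk3] := pE k.
      apply: (@le_trans _ _ (mu `](p k).1, (p k).2[%classic)).
        by rewrite lebesgue_measure_itv/= lte_fin pk EFinB.
      apply: le_measure; rewrite ?inE;
        [exact: measurable_itv|exact: mI|exact: pk3].
    have <- : (mu (\big[setU/set0]_(k < n) I k) = \sum_(0 <= k < n) mu (I k))%E.
      rewrite big_mkord; apply: measure_bigsetU_ord => [k|]; first exact: mI.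
      by move=> i j _ _ h; apply: ord_inj; exact: tI.
    apply: le_measure; rewrite ?inE; [|exact: mU|].
      by apply: bigsetU_measurable => k _; exact: mI.
    by rewrite UE; exact: bigsetU_bigcup.
have nufin : fin_num_fun nu.
  apply: lty_fin_num_fun; exact: le_lt_trans nuT (ltry _).
pose nuf : {finite_measure set (measurableTypeR R) -> \bar R} :=
  HB.pack nu (Measure_isFinite.Build _ _ _ nu nufin).
have rho0 : mu.-integrable setT (Radon_Nikodym_SigmaFinite.f nuf mu).
  exact: Radon_Nikodym_SigmaFinite.f_integrable.
have rhoE := Radon_Nikodym_SigmaFinite.f_integral (nu := nuf) (mu := mu) numu.
have rhofin := Radon_Nikodym_SigmaFinite.f_fin_num (nu := nuf) (mu := mu) numu.
exists (fine \o Radon_Nikodym_SigmaFinite.f nuf mu).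
  by apply: eq_integrable rho0 => // x _ /=; rewrite fineK.
move=> x xab; have xa : a <= x by move: xab; rewrite in_itv/= => /andP[].
have := rhoE `]a, x]%classic (measurable_itv _).
rewrite [LHS]nuE// /Gx !clamp_id// ?bound_itvE// => ->.
by apply: eq_integral => t _ /=; rewrite fineK.
Qed.

End StieltjesDensity.

(** * Integral representation of absolutely continuous functions *)

Section AbsolutelyContinuousFTC.
Variable R : realType.
Local Notation mu := (@lebesgue_measure R).
Implicit Types (a b : R) (f : R -> R).

(** With V the variation function, f = V - (V - f). The second term is nondecreasing as well,
    because an increment of f is at most the corresponding increment of V. *)
Lemma abs_continuous_density a b f : a <= b -> abs_continuous a b f ->
  exists2 rho : R -> R, mu.-integrable setT (EFin \o rho) &
  forall x, x \in `[a, b] -> f x - f a = \int[mu]_(t in `]a, x]) rho t.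
Proof.
move=> ab /abs_continuous_seq acf.
pose V x := fine (total_variation a x f).
have acV : seq_abs_continuous a b V := seq_abs_continuous_variation acf.
have incr s t : a <= s -> s <= t -> t <= b -> `|f t - f s| <= V t - V s.
  move=> sa st tb; rewrite -lee_fin -(total_variation_increment sa st tb acf).
  exact: total_variation_ge.
have ndV : {in `[a, b] &, nondecreasing_fun V}.
  move=> s t; rewrite !in_itv/= => /andP[sa sb] /andP[ta tb] st.
  by have := incr s t sa st tb; have := normr_ge0 (f t - f s); lra.
have ndN : {in `[a, b] &, nondecreasing_fun (V \- f)}.
  move=> s t; rewrite !in_itv/= => /andP[sa sb] /andP[ta tb] st /=.
  by have := incr s t sa st tb; have := ler_norm (f t - f s); lra.
have [r1 ir1 r1E] := monotone_density ab ndV acV.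
have [r2 ir2 r2E] := monotone_density ab ndN (seq_abs_continuousB acV acf).
exists (r1 \- r2).
  by apply: eq_integrable (integrableB _ ir1 ir2).
move=> x xab; rewrite RintegralB//; last 2 first.
- exact: integrableS ir1.
- exact: integrableS ir2.
by rewrite /Rintegral -r1E// -r2E//=; ring.
Qed.

Lemma abs_continuous_derive1_ae a b f rho : mu.-integrable setT (EFin \o rho) ->
  (forall x, x \in `[a, b] -> f x - f a = \int[mu]_(t in `]a, x]) rho t) ->
  {ae mu, forall x, x \in `]a, b[ -> derive1 f x = rho x}.
Proof.
move=> irho fE.
have irhoS A : measurable A -> mu.-integrable A (EFin \o rho).
  by move=> mA; exact: integrableS irho.
have locrho : locally_integrable [set: R] rho.
  by apply: open_integrable_locally => //; exact: openT.
have := @FTC1 R rho (BRight a) (fun y => irhoS _ (measurable_itv _)) locrho.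
apply: filterS; first exact: (ae_filter_ringOfSetsType mu).
move=> x /= ftc xab.
have ax : a < x by move: xab; rewrite in_itv => /andP[].
have [] := ftc ax.
set F := fun y : R => _ => dF <-; rewrite !derive1E.
(* Near an interior point, f is the indefinite integral of [rho] plus the constant f a. *)
transitivity ('D_1 (F + cst (f a)) x); last first.
  by rewrite (deriveD dF (derivable_cst _ _ _)) derive_cst addr0.
apply: near_eq_derive; near=> z.
have zab : z \in `[a, b].
  by apply: (@subset_itv_oo_cc _ _ a b); near: z; exact: near_in_itvoo.
by rewrite fctE /F -fE//= /cst subrK.
Unshelve. all: by end_near. Qed.

(** The density and [derive1 f] agree almost everywhere, so they have the same integrals;
    integrability of [derive1 f] provides the measurability that this comparison requires. *)
Theorem abs_continuous_FTC a b f : a <= b -> abs_continuous a b f ->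
  mu.-integrable `]a, b[ (EFin \o derive1 f) ->
  forall x, x \in `[a, b] -> \int[mu]_(t in `]a, x[) derive1 f t = f x - f a.
Proof.
move=> ab acf idf x xab; have [rho irho fE] := abs_continuous_density ab acf.
have ae := abs_continuous_derive1_ae irho fE.
have axb : `]a, x[ `<=` `]a, b[.
  apply: set_interval.subset_itvl; rewrite bnd_simp.
  by move: xab; rewrite in_itv/= => /andP[].
rewrite fE// -Rintegral_itv_bndo_bndc; last exact: integrableS irho.
congr fine; apply: ae_eq_integral => //.
- by apply: measurable_funS (measurable_int _ idf).
- apply: (measurable_int mu).
  by have : mu.-integrable `]a, x[ (EFin \o rho) by exact: integrableS irho.
- apply: filterS ae; first exact: (ae_filter_ringOfSetsType mu).
  by move=> t /= + /axb => /[apply] ->.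
Qed.

End AbsolutelyContinuousFTC.

(** * Fubini on a triangle and the power kernel *)

Lemma integral_patchZ (R : realType) (D : set (measurableTypeR R)) (c : R)
    (h : R -> R) :
  measurable D -> (@lebesgue_measure R).-integrable D (EFin \o h) ->
  (\int[lebesgue_measure]_t (((fun s => c * h s) \_ D) t)%:E =
   (c * \int[lebesgue_measure]_(t in D) h t)%:E)%E.
Proof.
move=> mD ih; rewrite -RintegralZl// /Rintegral fineK; last first.
  apply: integrable_fin_num => //.
  exact: (integrableZl mD c ih).
rewrite [RHS]integral_mkcond; apply: eq_integral => t _.
by rewrite !patchE; case: ifP.
Qed.

Section TriangleFubini.
Variable R : realType.
Local Notation mu := (@lebesgue_measure R).
Local Notation T := (measurableTypeR R).
Variables (a b : R) (k : T * T -> R) (f u : T -> R).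
Hypothesis mk : measurable_fun setT k.
Hypothesis mf : measurable_fun `]a, b[ f.
Hypothesis mu_u : measurable_fun `]a, b[ u.

(** The common integrand of the two iterated integrals, extended by 0 off the triangle a < t < x <
    b, with x = [z.1] and t = [z.2]. Fubini can then be applied on the whole plane. *)
Let K (z : T * T) : R :=
  if z.2 < z.1 then k z * ((f \_ `]a, b[) z.1 * (u \_ `]a, b[) z.2) else 0.

Let measurable_K : measurable_fun setT K.
Proof.
apply: measurable_fun_ifT => //.
  by apply: measurable_fun_ltr.
apply: measurable_funM => //.
apply: measurable_funM.
  apply: (measurableT_comp (f := f \_ `]a, b[)) => //.
  exact/(measurable_restrictT _ _).1.
apply: (measurableT_comp (f := u \_ `]a, b[)) => //.
exact/(measurable_restrictT _ _).1.
Qed.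

Let abs_K : measurable_fun setT (fun z => `|(EFin \o K) z|%E).
Proof. by apply: measurableT_comp => //; exact/measurable_EFinP. Qed.

Let abs_K_ge0 z : (0 <= `|(EFin \o K) z|)%E.
Proof. by []. Qed.

Let K_left x : x \in `]a, b[ ->
  (fun t => K (x, t)) = (fun t => f x * (k (x, t) * u t)) \_ `]a, x[.
Proof.
move=> xab; apply/funext => t; rewrite /K/= !patchE !mem_setE xab !in_itv/=.
have [tx|tx] := ltP t x; last by rewrite andbF.
have -> : t < b by move: xab; rewrite in_itv/= => /andP[_]; exact: lt_trans.
by case: ifP => //= _; rewrite ?mulr0// mulrCA.
Qed.

Let K_right t : t \in `]a, b[ ->
  (fun x => K (x, t)) = (fun x => u t * (k (x, t) * f x)) \_ `]t, b[.
Proof.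
move=> tab; apply/funext => x; rewrite /K/= !patchE !mem_setE tab !in_itv/=.
have [tx|tx] := ltP t x => //=.
have -> /= : a < x by move: tab; rewrite in_itv/= => /andP[/lt_trans + _]; exact.
by case: ifP => //= _; rewrite ?mul0r ?mulr0//; ring.
Qed.

Let K_left0 x : x \notin `]a, b[ -> (fun t => K (x, t)) = cst 0.
Proof.
move=> /negbTE xab; apply/funext => t; rewrite /K/= patchE mem_setE xab.
by rewrite mul0r mulr0; case: ifP.
Qed.

Let K_right0 t : t \notin `]a, b[ -> (fun x => K (x, t)) = cst 0.
Proof.
move=> /negbTE tab; apply/funext => x; rewrite /K/= (patchE u) mem_setE tab.
by rewrite !mulr0; case: ifP.
Qed.

Hypothesis ku : forall x, x \in `]a, b[ ->
  mu.-integrable `]a, x[ (EFin \o (fun t => k (x, t) * u t)).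
Hypothesis kf : forall t, t \in `]a, b[ ->
  mu.-integrable `]t, b[ (EFin \o (fun x => k (x, t) * f x)).

Let triangle_Fubini_integrable :
  (mu \x mu)%E.-integrable setT (EFin \o K) ->
  \int[mu]_(x in `]a, b[) (f x * \int[mu]_(t in `]a, x[) (k (x, t) * u t)) =
  \int[mu]_(t in `]a, b[) (u t * \int[mu]_(x in `]t, b[) (k (x, t) * f x)).
Proof.
move=> /Fubini; rewrite /= => KE; rewrite /Rintegral.
have <- : (\int[mu]_x \int[mu]_t (K (x, t))%:E = \int[mu]_(x in `]a, b[)
    (f x * \int[mu]_(t in `]a, x[) (k (x, t) * u t))%:E)%E.
  rewrite [RHS]integral_mkcond; apply: eq_integral => x _.
  rewrite patchE mem_setE; case: ifPn => xab.
    rewrite -(integral_patchZ (f x) (measurable_itv _) (ku xab)).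
    by rewrite -(K_left xab).
  by under eq_integral do rewrite (congr1 (@^~ _) (K_left0 xab)); rewrite integral0.
have <- : (\int[mu]_t \int[mu]_x (K (x, t))%:E = \int[mu]_(t in `]a, b[)
    (u t * \int[mu]_(x in `]t, b[) (k (x, t) * f x))%:E)%E.
  rewrite [RHS]integral_mkcond; apply: eq_integral => t _.
  rewrite patchE mem_setE; case: ifPn => tab.
    rewrite -(integral_patchZ (u t) (measurable_itv _) (kf tab)).
    by rewrite -(K_right tab).
  by under eq_integral do rewrite (congr1 (@^~ _) (K_right0 tab)); rewrite integral0.
by rewrite KE.
Qed.

(** By Tonelli, integrating |K| first in x gives at most C |u(t)|, which is integrable; hence K is
    integrable on the plane. *)
Lemma triangle_Fubini_right (C : R) : mu.-integrable `]a, b[ (EFin \o u) ->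
  (forall t, t \in `]a, b[ -> \int[mu]_(x in `]t, b[) `|k (x, t) * f x| <= C) ->
  \int[mu]_(x in `]a, b[) (f x * \int[mu]_(t in `]a, x[) (k (x, t) * u t)) =
  \int[mu]_(t in `]a, b[) (u t * \int[mu]_(x in `]t, b[) (k (x, t) * f x)).
Proof.
move=> iu kfC; apply: triangle_Fubini_integrable.
apply/integrable21ltyP; first exact/measurable_EFinP.
apply: (@le_lt_trans _ _ (\int[mu]_t (((fun t => C * `|u t|) \_ `]a, b[) t)%:E)%E).
  apply: ge0_le_integral; first exact: measurableT.
  - by move=> t _; exact: integral_ge0.
  - exact: (@measurable_fun_fubini_tonelli_G _ _ _ _ R mu _ abs_K abs_K_ge0).
  - apply/measurable_EFinP/(measurable_restrictT _ _).1 => //.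
    by apply: measurable_funM => //; exact: measurableT_comp.
  - move=> t _; rewrite patchE mem_setE; case: ifPn => tab; last first.
      by under eq_integral do rewrite /= (congr1 (@^~ _) (K_right0 tab)) normr0;
        rewrite integral0.
    have -> : (fun x => `|(EFin \o K) (x, t)|%E) = (fun x =>
        (((fun x => `|u t| * `|k (x, t) * f x|) \_ `]t, b[) x)%:E).
      apply/funext => x /=; rewrite (congr1 (@^~ x) (K_right tab)) !patchE.
      by case: ifP => _; rewrite ?normr0// normrM.
    rewrite integral_patchZ//; last first.
      exact: (integrable_norm (kf tab)).
    by rewrite lee_fin mulrC ler_wpM2r// kfC.
rewrite integral_patchZ ?ltry//.
exact: (integrable_norm iu).
Qed.

(** The same argument integrating first in t, for the case where f is merely integrable and the
    uniform bound concerns u. *)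
Lemma triangle_Fubini_left (C : R) : mu.-integrable `]a, b[ (EFin \o f) ->
  (forall x, x \in `]a, b[ -> \int[mu]_(t in `]a, x[) `|k (x, t) * u t| <= C) ->
  \int[mu]_(x in `]a, b[) (f x * \int[mu]_(t in `]a, x[) (k (x, t) * u t)) =
  \int[mu]_(t in `]a, b[) (u t * \int[mu]_(x in `]t, b[) (k (x, t) * f x)).
Proof.
move=> if_ kuC; apply: triangle_Fubini_integrable.
apply/integrable12ltyP; first exact/measurable_EFinP.
apply: (@le_lt_trans _ _ (\int[mu]_x (((fun x => C * `|f x|) \_ `]a, b[) x)%:E)%E).
  apply: ge0_le_integral; first exact: measurableT.
  - by move=> x _; exact: integral_ge0.
  - exact: (@measurable_fun_fubini_tonelli_F _ _ _ _ R mu _ abs_K abs_K_ge0).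
  - apply/measurable_EFinP/(measurable_restrictT _ _).1 => //.
    by apply: measurable_funM => //; exact: measurableT_comp.
  - move=> x _; rewrite patchE mem_setE; case: ifPn => xab; last first.
      by under eq_integral do rewrite /= (congr1 (@^~ _) (K_left0 xab)) normr0;
        rewrite integral0.
    have -> : (fun t => `|(EFin \o K) (x, t)|%E) = (fun t =>
        (((fun t => `|f x| * `|k (x, t) * u t|) \_ `]a, x[) t)%:E).
      apply/funext => t /=; rewrite (congr1 (@^~ t) (K_left xab)) !patchE.
      by case: ifP => _; rewrite ?normr0// normrM.
    rewrite integral_patchZ//; last first.
      exact: (integrable_norm (ku xab)).
    by rewrite lee_fin mulrC ler_wpM2r// kuC.
rewrite integral_patchZ ?ltry//.
exact: (integrable_norm if_).
Qed.

End TriangleFubini.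

(** * Bounds on the integral of the power kernel *)

Section PowerKernel.
Variable R : realType.
Local Notation mu := (@lebesgue_measure R).

(** Monotone convergence along an exhaustion of ]a, b[. It reduces a kernel that may be singular at
    an end point to compact subintervals, where the fundamental theorem of calculus applies. *)
Lemma ge0_integral_oo_le (g : measurableTypeR R -> R) (a b M : R) :
  (forall x, x \in `]a, b[ -> 0 <= g x) -> measurable_fun `]a, b[ g -> 0 <= M ->
  (forall c d, a < c -> c < d -> d < b ->
    (\int[mu]_(x in `[c, d]) (g x)%:E <= M%:E)%E) ->
  (\int[mu]_(x in `]a, b[) (g x)%:E <= M%:E)%E.
Proof.
move=> g0 mg M0 gM.
pose F (n : nat) : set (measurableTypeR R) :=
  `](a + n.+1%:R^-1), (b - n.+1%:R^-1)[%classic.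
have Fab n : F n `<=` `]a, b[%classic.
  by apply: set_interval.subset_itv; rewrite bnd_simp ?lerDl ?gerBl.
have UF : `]a, b[%classic = \bigcup_n F n.
  apply/seteqP; split => x /=; last by case=> n _ /Fab.
  rewrite in_itv/= => /andP[ax xb].
  have e0 : 0 < Num.min (x - a) (b - x) by rewrite lt_min !subr_gt0 ax.
  have [n _ /(_ n (leqnn n))] := near_infty_natSinv_lt (PosNum e0).
  by rewrite /= lt_min => /andP[h1 h2]; exists n => //; rewrite /F/= in_itv/=;
    apply/andP; split; [rewrite -ltrBrDl|rewrite ltrBrDr -ltrBrDl].
have ndF : nondecreasing_seq F.
  move=> m n mn; apply/subsetPset; apply: set_interval.subset_itv;
    by rewrite bnd_simp ?lerD2l ?lerN2 lef_pV2 ?posrE// ler_nat.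
have mF n : measurable (F n) by exact: measurable_itv.
have mgF n : measurable_fun (F n) (EFin \o g).
  by apply/measurable_EFinP; apply: measurable_funS mg.
have gF0 n x : F n x -> (0 <= (EFin \o g) x)%E.
  by move=> /Fab xab; rewrite lee_fin g0.
rewrite UF.
apply: (cvge_to_le
  (@ge0_nondecreasing_set_cvg_integral _ _ R F _ mu ndF mF mgF gF0)).
apply: nearW => n.
(* For small n the interval may be empty or a single excluded point; its integral is then 0, at most
   M. *)
have [cd|dc] := ltP (a + n.+1%:R^-1) (b - n.+1%:R^-1); last first.
  rewrite /F set_itv_ge; first by rewrite integral_set0 lee_fin.
  by rewrite bnd_simp -leNgt.
rewrite -(@integral_itv_bndoo _ _ _ _ true false).
  by apply: gM => //; rewrite ?ltrDl ?gtrBl.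
exact: mgF.
Qed.

Lemma derivable_FTC2 (g F : R -> R) (c d : R) : c < d ->
  (forall x, x \in `[c, d] -> derivable g x 1) ->
  (forall x, x \in `[c, d] -> is_derive x 1 F (g x)) ->
  (\int[mu]_(x in `[c, d]) (g x)%:E = (F d)%:E - (F c)%:E)%E.
Proof.
move=> cd dg dF.
have cF x : x \in `[c, d] -> {for x, continuous F}.
  move=> /dF[dFx _]; apply: differentiable_continuous.
  exact/derivable1_diffP.
apply: continuous_FTC2 => //.
- exact: derivable_within_continuous.
- split.
  + by move=> x /subset_itv_oo_cc/dF[].
  + by apply: cvg_at_right_filter; apply: cF; rewrite bound_itvE ltW.
  + by apply: cvg_at_left_filter; apply: cF; rewrite bound_itvE ltW.
- by move=> x /subset_itv_oo_cc/dF[_ <-]; rewrite derive1E.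
Qed.

Variable gam : R.
Hypothesis gam1 : gam < 1.

(** The antiderivative of y^(-gam) on y > 0. *)
Let G (y : R) := (1 - gam)^-1 * y `^ (1 - gam).

Let G_ge0 y : 0 <= G y.
Proof. by rewrite mulr_ge0 ?powR_ge0// invr_ge0 subr_ge0 ltW. Qed.

Let G_is_derive (y : R) : 0 < y -> is_derive y 1 G (y `^ (- gam)).
Proof.
move=> y0; have dy := is_derive1_powR (1 - gam) y0.
have := @is_deriveZ _ _ _ _ (1 - gam)^-1 _ _ _ dy.
move=> /is_derive_eq; apply; rewrite /GRing.scale/= mulrA mulVf ?mul1r.
  by congr powR; ring.
by rewrite subr_eq0 eq_sym lt_eqF.
Qed.

Let shift_is_derive (s x : R) : is_derive x 1 (fun z => z - s) 1.
Proof. by apply: is_derive_eq; rewrite subr0. Qed.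

Let rev_is_derive (s x : R) : is_derive x 1 (fun z => s - z) (- 1).
Proof.
have := is_deriveB (is_derive_cst s x 1) (is_derive_id x 1).
by move=> /is_derive_eq; apply; rewrite sub0r.
Qed.

(** On [c, d] the integral is G (d - s) - G (c - s); the subtracted term is nonnegative and dropped,
    and G is nondecreasing. The upper bound suffices to supply the constant of the Fubini lemmas. *)
Lemma integral_power_right_le (s b : R) : s < b ->
  (\int[mu]_(x in `]s, b[) ((x - s) `^ (- gam))%:E <=
   ((1 - gam)^-1 * (b - s) `^ (1 - gam))%:E)%E.
Proof.
move=> sb; apply: ge0_integral_oo_le.
- by move=> x _; exact: powR_ge0.
- apply: (measurableT_comp (measurable_powR _)).
  by apply: measurable_funB => //; exact: measurable_cst.
- exact: G_ge0.
move=> c d sc cd db.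
have -> : (\int[mu]_(x in `[c, d]) ((x - s) `^ (- gam))%:E =
    (G (d - s))%:E - (G (c - s))%:E)%E.
  apply: (derivable_FTC2 (F := fun x => G (x - s)) cd) => x;
    rewrite in_itv/= => /andP[cx _]; have xs : 0 < x - s by lra.
  - have dp := is_derive1_powR (- gam) xs.
    by have [] := @is_derive1_comp _ (@powR R ^~ (- gam)) (fun z => z - s)
      x _ _ dp (shift_is_derive s x).
  - have := @is_derive1_comp _ G (fun z => z - s) x _ _
      (G_is_derive xs) (shift_is_derive s x).
    by move=> /is_derive_eq; apply; rewrite mulr1.
rewrite -EFinB lee_fin; apply: (@le_trans _ _ (G (d - s))).
  by rewrite gerBl G_ge0.
rewrite ler_wpM2l ?invr_ge0 ?subr_ge0 ?(ltW gam1)//.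
by apply: ge0_ler_powR; rewrite ?nnegrE ?subr_ge0 ?(ltW gam1)//; lra.
Qed.

Lemma integral_power_left_le (a x : R) : a < x ->
  (\int[mu]_(t in `]a, x[) ((x - t) `^ (- gam))%:E <=
   ((1 - gam)^-1 * (x - a) `^ (1 - gam))%:E)%E.
Proof.
move=> ax; apply: ge0_integral_oo_le.
- by move=> t _; exact: powR_ge0.
- apply: (measurableT_comp (measurable_powR _)).
  by apply: measurable_funB => //; exact: measurable_cst.
- exact: G_ge0.
move=> c d ac cd dx.
have -> : (\int[mu]_(t in `[c, d]) ((x - t) `^ (- gam))%:E =
    (- G (x - d))%:E - (- G (x - c))%:E)%E.
  apply: (derivable_FTC2 (F := fun t => - G (x - t)) cd) => t;
    rewrite in_itv/= => /andP[_ td]; have xt : 0 < x - t by lra.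
  - have dp := is_derive1_powR (- gam) xt.
    by have [] := @is_derive1_comp _ (@powR R ^~ (- gam)) (fun z => x - z)
      t _ _ dp (rev_is_derive x t).
  - have := is_deriveN (@is_derive1_comp _ G (fun z => x - z) t _ _
      (G_is_derive xt) (rev_is_derive x t)).
    by move=> /is_derive_eq; apply; rewrite mulrN1 opprK.
rewrite -EFinB lee_fin opprK addrC; apply: (@le_trans _ _ (G (x - c))).
  by rewrite gerBl G_ge0.
rewrite ler_wpM2l ?invr_ge0 ?subr_ge0 ?(ltW gam1)//.
by apply: ge0_ler_powR; rewrite ?nnegrE ?subr_ge0 ?(ltW gam1)//; lra.
Qed.

End PowerKernel.

(** * Integration by parts *)

Section WithinDerivative.
Variable R : realType.
Local Notation mu := (@lebesgue_measure R).
Implicit Types (a b x t : R) (f y Phi : R -> R).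

Lemma derivable_within_cvg (A : set R) f x : derivable_within A f x ->
  f z @[z --> within A x^'] --> f x.
Proof.
move=> /cvg_ex[/= l fl].
have zx : z @[z --> within A x^'] --> x.
  by apply: cvg_within_filter; apply: cvg_within_filter; exact: cvg_id.
have : diff_quot f x z * (z - x) + f x @[z --> within A x^'] --> l * (x - x) + f x.
  apply: cvgD; last exact: cvg_cst.
  by apply: cvgM => //; apply: cvgB => //; exact: cvg_cst.
rewrite subrr mulr0 add0r; apply: cvg_trans; apply: near_eq_cvg.
rewrite near_withinE /dnbhs near_withinE; near=> z => /= zx' _.
by rewrite /diff_quot mulfVK ?subrK// subr_eq0.
Unshelve. all: by end_near. Qed.

(** Points slightly to the right of x < b stay in [a, b], so a limit within [a, b] gives a right
    limit. *)
Lemma within_sub_at_right a b x : x \in `[a, b[ ->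
  within `[a, b] x^' `<=` x^'+.
Proof.
rewrite in_itv/= => /andP[ax xb] U; rewrite /nbhs/= /within/= /dnbhs /within/= => H.
have {}H : \forall z \near x^'+, z != x -> `[a, b]%classic z -> U z.
  by apply: cvg_within; exact: H.
suff : \forall z \near x^'+, U z by [].
near=> z.
have zU : z != x -> `[a, b]%classic z -> U z by near: z; exact: H.
apply: zU.
  by rewrite gt_eqF//; near: z; exact: nbhs_right_gt.
have xz : x <= z by near: z; exact: nbhs_right_ge.
have zb : z <= b by near: z; exact: nbhs_right_le.
by rewrite /= in_itv/= zb (le_trans ax).
Unshelve. all: by end_near. Qed.

Lemma within_sub_at_left a b x : x \in `]a, b] ->
  within `[a, b] x^' `<=` x^'-.
Proof.
rewrite in_itv/= => /andP[ax xb] U; rewrite /nbhs/= /within/= /dnbhs /within/= => H.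
have {}H : \forall z \near x^'-, z != x -> `[a, b]%classic z -> U z.
  by apply: cvg_within; exact: H.
suff : \forall z \near x^'-, U z by [].
near=> z.
have zU : z != x -> `[a, b]%classic z -> U z by near: z; exact: H.
apply: zU.
  by rewrite lt_eqF//; near: z; exact: nbhs_left_lt.
have az : a <= z by near: z; exact: nbhs_left_ge.
have zx : z <= x by near: z; exact: nbhs_left_le.
by rewrite /= in_itv/= az (le_trans zx).
Unshelve. all: by end_near. Qed.

(** As a < b, every point of [a, b] can be approached from inside on at least one side. Properness
    makes limits unique, hence computable by [cvg_lim]. *)
Lemma within_itv_proper a b x : a < b -> x \in `[a, b] ->
  ProperFilter (within `[a, b] x^').
Proof.
move=> ab; rewrite in_itv/= => /andP[ax xb].
split; last exact: within_filter.
have [xb'|bx] := ltP x b.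
  move/(@within_sub_at_right a b x); rewrite in_itv/= ax xb' => /(_ isT).
  exact: filter_not_empty.
move/(@within_sub_at_left a b x).
rewrite in_itv/= xb (lt_le_trans ab bx) => /(_ isT).
exact: filter_not_empty.
Qed.

Lemma derivable_within_at_right a b f x : x \in `[a, b[ ->
  derivable_within `[a, b] f x -> f z @[z --> x^'+] --> f x.
Proof.
move=> xab /derivable_within_cvg; apply: cvg_trans; apply: cvg_app.
exact: within_sub_at_right.
Qed.

Lemma derivable_within_at_left a b f x : x \in `]a, b] ->
  derivable_within `[a, b] f x -> f z @[z --> x^'-] --> f x.
Proof.
move=> xab /derivable_within_cvg; apply: cvg_trans; apply: cvg_app.
exact: within_sub_at_left.
Qed.

Lemma derive_withinDZ a b (f g h : R -> R) (l : R) x : a < b -> x \in `[a, b] ->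
  (forall z, z \in `[a, b] -> h z = f z + l * g z) ->
  derivable_within `[a, b] f x -> derivable_within `[a, b] g x ->
  derivable_within `[a, b] h x /\
  derive_within `[a, b] h x =
    derive_within `[a, b] f x + l * derive_within `[a, b] g x.
Proof.
move=> ab xab hE df dg; have pF := within_itv_proper ab xab.
have cv : diff_quot h x z @[z --> within `[a, b] x^'] -->
    derive_within `[a, b] f x + l * derive_within `[a, b] g x.
  have : diff_quot f x z + l * diff_quot g x z @[z --> within `[a, b] x^'] -->
      derive_within `[a, b] f x + l * derive_within `[a, b] g x.
    by apply: cvgD => //; apply: cvgM => //; exact: cvg_cst.
  apply: cvg_trans; apply: near_eq_cvg; rewrite near_withinE; near=> z => zab.
  by rewrite /diff_quot !hE//; ring.
split; last by apply/cvg_lim.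
by apply/cvg_ex; eexists; exact: cv.
Unshelve. all: by end_near. Qed.

(** Around an interior point the restriction to [a, b] is vacuous; the substitution z = h + x turns
    the quotient into that of [is_derive]. *)
Lemma derivable_within_itv_is_derive a b f x : x \in `]a, b[ ->
  derivable_within `[a, b] f x -> is_derive x 1 f (derive_within `[a, b] f x).
Proof.
move=> xab dfx.
have cv : diff_quot f x z @[z --> x^'] --> derive_within `[a, b] f x.
  apply: cvg_trans dfx; apply: cvg_app => U.
  rewrite /nbhs/= /within/= /dnbhs /within/= => H.
  suff : \forall z \near x, z != x -> U z by [].
  near=> z => zx.
  have zU : z != x -> `[a, b]%classic z -> U z by near: z; exact: H.
  apply: zU => //.
  have zab : z \in `]a, b[ by near: z; exact: (near_in_itvoo xab).
  by rewrite /= subset_itv_oo_cc.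
have cv0 : (fun h => h^-1 *: (f (h *: 1 + x) - f x)) @ 0^' -->
    derive_within `[a, b] f x.
  have sh : h + x @[h --> 0^'] --> x^'.
    move=> U; rewrite /nbhs/= /dnbhs /within/= => H.
    suff : \forall h \near (0 : R), h != 0 -> U (h + x) by [].
    have : h + x @[h --> (0 : R)] --> 0 + x.
      by apply: cvgD; [exact: cvg_id|exact: cvg_cst].
    rewrite add0r => /(_ _ H) {}H; near=> h => h0.
    have Uh : h + x != x -> U (h + x) by near: h; exact: H.
    by apply: Uh; rewrite -subr_eq0 addrK.
  apply: cvg_trans (cvg_comp _ _ sh cv); apply: near_eq_cvg.
  near=> h; rewrite /= /diff_quot addrK mulrC [h *: 1]mulr1.
  by [].
split; first by apply/cvg_ex; exists (derive_within `[a, b] f x).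
by apply/cvg_lim.
Unshelve. all: by end_near. Qed.

End WithinDerivative.

(** * Integration by parts for absolutely continuous functions *)

Section IntegrationByParts.
Variable R : realType.
Local Notation mu := (@lebesgue_measure R).
Implicit Types (a b x t : R) (f y Phi : R -> R).

Lemma continuous_itv_integrable a b f s t : a <= s -> t <= b ->
  {within `[a, b], continuous f} -> mu.-integrable `]s, t[ (EFin \o f).
Proof.
move=> as_ tb cf; have icc : mu.-integrable `[a, b] (EFin \o f).
  by apply: continuous_compact_integrable => //; exact: segment_compact.
apply: integrableS icc => //.
by apply: set_interval.subset_itv; rewrite bnd_simp.
Qed.

Lemma continuous_itv_bounded a b f : {within `[a, b], continuous f} ->
  exists2 M, 0 <= M & forall x, x \in `[a, b] -> `|f x| <= M.
Proof.
move=> cf; have := continuous_compact cf (@segment_compact _ a b).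
move=> /compact_bounded[M [_ Mf]]; exists (`|M| + 1) => //.
move=> x xab; apply: (Mf (`|M| + 1)).
  by rewrite (le_lt_trans (ler_norm _))// ltrDl.
by exists x.
Qed.

Lemma abs_continuous_continuous a b f : abs_continuous a b f ->
  {within `[a, b], continuous f}.
Proof.
move=> /abs_continuous_seq acf; apply/subspace_continuousP => x /= xab.
apply/cvgrPdist_lt => e e0; have [d d0 small] := acf e e0.
have incr s t : s \in `[a, b] -> t \in `[a, b] -> s <= t -> t - s < d ->
    `|f t - f s| < e.
  rewrite !in_itv/= => /andP[as_ sb] /andP[at_ tb] st tsd.
  have := small [:: (s, t)].
  rewrite /total_length /increments !big_cons !big_nil/= !addr0.
  by apply => //; rewrite /inside/= as_ st tb.
near=> z.
have zab : z \in `[a, b] by near: z; exact: withinT.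
have zx : `|x - z| < d.
  near: z; apply: cvg_within; apply: (@cvgr_dist_lt _ _ _ (nbhs x)) => //.
have [xz|zx'] := leP x z.
  by rewrite distrC; apply: incr => //; move: zx; rewrite distrC ger0_norm ?subr_ge0.
by apply: incr => //; [exact: ltW|move: zx; rewrite ger0_norm// subr_ge0 ltW].
Unshelve. all: by end_near. Qed.

Lemma within_FTC2 a b Phi t : t \in `[a, b] ->
  (forall x, x \in `[a, b] -> derivable_within `[a, b] Phi x) ->
  {within `[a, b], continuous (derive_within `[a, b] Phi)} ->
  \int[mu]_(x in `]t, b[) derive_within `[a, b] Phi x = Phi b - Phi t.
Proof.
rewrite in_itv/= => /andP[at_ tb] dPhi cphi.
move: tb; rewrite le_eqVlt => /predU1P[->|tb].
  by rewrite subrr set_itv_ge ?Rintegral_set0// bnd_simp ltxx.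
have sub x : x \in `]t, b[ -> x \in `]a, b[.
  by rewrite !in_itv/= => /andP[tx ->]; rewrite (le_lt_trans at_ tx).
have dP x : x \in `]t, b[ ->
    is_derive x 1 Phi (derive_within `[a, b] Phi x).
  move=> /sub xab; apply: derivable_within_itv_is_derive => //.
  by apply: dPhi; exact: subset_itv_oo_cc.
have ab : a <= b := le_trans at_ (ltW tb).
have iphi := continuous_itv_integrable at_ (lexx b) cphi.
rewrite /Rintegral -(@integral_itv_bndoo _ _ _ _ true false); last first.
  exact: measurable_int iphi.
rewrite (@continuous_FTC2 _ _ Phi)//.
- apply: continuous_subspaceW cphi.
  by apply: set_interval.subset_itvr; rewrite bnd_simp.
- split.
  + by move=> x /dP[].
  + apply: (derivable_within_at_right (a := a) (b := b)).
      by rewrite in_itv/= at_ tb.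
    by apply: dPhi; rewrite in_itv/= at_ ltW.
  + apply: (derivable_within_at_left (a := a) (b := b)).
      by rewrite in_itv/= lexx (le_lt_trans at_ tb).
    by apply: dPhi; rewrite in_itv/= lexx ab.
- by move=> x /dP[_ <-]; rewrite derive1E.
Qed.

End IntegrationByParts.

Section AbsolutelyContinuousIBP.
Variable R : realType.
Local Notation mu := (@lebesgue_measure R).
Implicit Types (a b x t : R) (f y Phi : R -> R).

Lemma ge0_subset_Rintegral (A B : set (measurableTypeR R)) (g : R -> R) :
  measurable A -> measurable B -> mu.-integrable B (EFin \o g) ->
  (forall x, B x -> 0 <= g x) -> A `<=` B ->
  \int[mu]_(x in A) g x <= \int[mu]_(x in B) g x.
Proof.
move=> mA mB ig g0 AB; rewrite /Rintegral fine_le//.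
- exact: (integrable_fin_num mA (integrableS mB mA AB ig)).
- exact: (integrable_fin_num mB ig).
- by apply: ge0_subset_integral => //; exact: measurable_int ig.
Qed.

Lemma integrable_continuousM a b (u : measurableTypeR R -> R) f :
  mu.-integrable `]a, b[ (EFin \o u) -> {within `[a, b], continuous f} ->
  mu.-integrable `]a, b[ (EFin \o (fun t => u t * f t)).
Proof.
move=> iu cf; have [M M0 fM] := continuous_itv_bounded cf.
have mf : measurable_fun (`]a, b[ : set (measurableTypeR R)) f.
  apply/measurable_EFinP; apply: (measurable_int mu).
  exact: continuous_itv_integrable cf.
have bf : [bounded f t | t in (`]a, b[ : set (measurableTypeR R))].
  exists M; split; first exact: ger0_real.
  by move=> x Mx t /= /subset_itv_oo_cc tab; exact: le_trans (fM _ tab) (ltW Mx).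
by apply: (integrableMl _ iu mf bf); exact: measurable_itv.
Qed.

Lemma continuous_itvM a b f g : {within `[a, b], continuous f} ->
  {within `[a, b], continuous g} ->
  {within `[a, b], continuous (fun x => f x * g x)}.
Proof.
by move=> cf cg x; apply: cvgM; [exact: cf|exact: cg].
Qed.

(** Fubini on the triangle with the constant kernel 1, applied to phi(x) y'(t). [E1] and [E2]
    evaluate the two iterated integrals by the fundamental theorem for y and for Phi respectively;
    equating them gives the formula. *)
Lemma abs_continuous_IBP a b y Phi : a < b -> abs_continuous a b y ->
  mu.-integrable `]a, b[ (EFin \o derive1 y) ->
  (forall x, x \in `[a, b] -> derivable_within `[a, b] Phi x) ->
  {within `[a, b], continuous (derive_within `[a, b] Phi)} ->
  \int[mu]_(t in `]a, b[) (derive1 y t * Phi t) =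
  Phi b * y b - Phi a * y a -
    \int[mu]_(x in `]a, b[) (y x * derive_within `[a, b] Phi x).
Proof.
move=> ab acy iy' dPhi cphi; have ab' := ltW ab.
set phi := derive_within _ _ in cphi *.
have cy := abs_continuous_continuous acy.
have cPhi : {within `[a, b], continuous Phi}.
  apply/(continuous_within_itvP _ ab); split.
  - move=> x xab; apply: differentiable_continuous; apply/derivable1_diffP.
    have dx := dPhi x (subset_itv_oo_cc xab).
    by have [] := derivable_within_itv_is_derive xab dx.
  - apply: (derivable_within_at_right (a := a) (b := b)).
      by rewrite in_itv/= lexx.
    by apply: dPhi; rewrite in_itv/= lexx.
  - apply: (derivable_within_at_left (a := a) (b := b)).
      by rewrite in_itv/= lexx andbT.
    by apply: dPhi; rewrite in_itv/= lexx ab'.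
have iphi : mu.-integrable `]a, b[ (EFin \o phi).
  exact: continuous_itv_integrable cphi.
have iphiS t : t \in `]a, b[ -> mu.-integrable `]t, b[ (EFin \o phi).
  rewrite in_itv/= => /andP[at_ _].
  by apply: continuous_itv_integrable cphi => //; exact: ltW.
have iy'S x : x \in `]a, b[ -> mu.-integrable `]a, x[ (EFin \o derive1 y).
  rewrite in_itv/= => /andP[_ xb]; apply: integrableS iy' => //.
  by apply: set_interval.subset_itvl; rewrite bnd_simp ltW.
have iyphi : mu.-integrable `]a, b[ (EFin \o (fun x => y x * phi x)).
  exact: continuous_itv_integrable (continuous_itvM cy cphi).
have iy'Phi : mu.-integrable `]a, b[ (EFin \o (fun t => derive1 y t * Phi t)).
  exact: integrable_continuousM.
have E1 : \int[mu]_(x in `]a, b[)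
      (phi x * \int[mu]_(t in `]a, x[) (cst 1 (x, t) * derive1 y t)) =
    \int[mu]_(x in `]a, b[) (y x * phi x) - y a * (Phi b - Phi a).
  rewrite -(within_FTC2 _ dPhi cphi); last by rewrite in_itv/= lexx.
  rewrite -RintegralZl// -RintegralB//; last first.
    by apply: (integrableZl _ (y a) iphi); exact: measurable_itv.
  apply: eq_Rintegral => x; rewrite inE/= => xab.
  have -> : \int[mu]_(t in `]a, x[) (cst 1 (x, t) * derive1 y t) = y x - y a.
    rewrite -(abs_continuous_FTC ab' acy iy' (subset_itv_oo_cc xab)).
    by apply: eq_Rintegral => t _; rewrite mul1r.
  by rewrite -/phi; ring.
have E2 : \int[mu]_(t in `]a, b[)
      (derive1 y t * \int[mu]_(x in `]t, b[) (cst 1 (x, t) * phi x)) =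
    Phi b * (y b - y a) - \int[mu]_(t in `]a, b[) (derive1 y t * Phi t).
  rewrite -(abs_continuous_FTC ab' acy iy'); last by rewrite in_itv/= lexx ab'.
  rewrite -RintegralZl// -RintegralB//; last first.
    by apply: (integrableZl _ (Phi b) iy'); exact: measurable_itv.
  apply: eq_Rintegral => t; rewrite inE/= => tab.
  have -> : \int[mu]_(x in `]t, b[) (cst 1 (x, t) * phi x) = Phi b - Phi t.
    rewrite -(within_FTC2 (subset_itv_oo_cc tab) dPhi cphi).
    by apply: eq_Rintegral => x _; rewrite mul1r.
  by ring.
have algebra (A B : R) : A - y a * (Phi b - Phi a) = Phi b * (y b - y a) - B ->
  B = Phi b * y b - Phi a * y a - A by move=> {E1 E2} h; lra.
apply: algebra.
rewrite -E1 -E2.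
apply: (@triangle_Fubini_right R a b _ _ _ _ _ _ _ _
  (\int[mu]_(x in `]a, b[) `|phi x|)).
- exact: measurable_cst.
- by apply/measurable_EFinP; exact: (measurable_int mu).
- by apply/measurable_EFinP; exact: (measurable_int mu).
- move=> x xab; apply: eq_integrable (iy'S _ xab) => //.
  by move=> t _; rewrite /= mul1r.
- move=> t tab; apply: eq_integrable (iphiS _ tab) => //.
  by move=> x _; rewrite /= mul1r.
- exact: iy'.
- move=> t tab; under eq_Rintegral do rewrite mul1r.
  apply: ge0_subset_Rintegral => //; first exact: integrable_norm.
  apply: set_interval.subset_itvr; rewrite bnd_simp.
  by move: tab; rewrite in_itv/= => /andP[/ltW].
Qed.

End AbsolutelyContinuousIBP.

(** * Fractional integration by parts *)

Section FractionalIBP.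
Variable R : realType.
Local Notation mu := (@lebesgue_measure R).
Implicit Types (a b x t gam : R) (f y : R -> R).

(** Continuity yields the integrability of products that already contain the factor 1 / Gamma;
    dividing by c != 0 recovers that of h. *)
Lemma RintegralZl_neq0 (D : set (measurableTypeR R)) (c : R) (h : R -> R) :
  measurable D -> c != 0 -> mu.-integrable D (EFin \o (fun x => c * h x)) ->
  \int[mu]_(x in D) (c * h x) = c * \int[mu]_(x in D) h x.
Proof.
move=> mD c0 ich; have ih : mu.-integrable D (EFin \o h).
  apply: eq_integrable (integrableZl mD c^-1 ich) => //.
  by move=> x _ /=; rewrite -EFinM mulKf.
exact: RintegralZl.
Qed.

Lemma ge0_Rintegral_le (D : set (measurableTypeR R)) (h : R -> R) (M : R) :
  measurable D -> (forall x, D x -> 0 <= h x) ->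
  (\int[mu]_(x in D) (h x)%:E <= M%:E)%E -> \int[mu]_(x in D) h x <= M.
Proof.
move=> mD h0 hM; rewrite -lee_fin /Rintegral fineK// ge0_fin_numE.
  exact: le_lt_trans hM (ltry _).
by apply: integral_ge0 => x Dx; rewrite lee_fin h0.
Qed.

Lemma bounded_kernel_integral_le (D : set (measurableTypeR R))
    (k f : measurableTypeR R -> R) (M C : R) :
  measurable D -> measurable_fun D k -> measurable_fun D f ->
  (forall x, D x -> 0 <= k x) -> (forall x, D x -> `|f x| <= M) -> 0 <= M ->
  (\int[mu]_(x in D) (k x)%:E <= C%:E)%E ->
  \int[mu]_(x in D) `|k x * f x| <= M * C.
Proof.
move=> mD mk mf k0 fM M0 kC; apply: ge0_Rintegral_le => //.
apply: (@le_trans _ _ (M%:E * \int[mu]_(x in D) (k x)%:E)%E); last first.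
  by rewrite EFinM lee_wpmul2l.
have k0' x : D x -> (0 <= (k x)%:E)%E by move=> Dx; rewrite lee_fin k0.
have mk' : measurable_fun D (EFin \o k) by exact/measurable_EFinP.
rewrite -(ge0_integralZl_EFin mu mD k0' mk' M0).
apply: ge0_le_integral => //.
- by apply/measurable_EFinP; apply: measurableT_comp => //; exact: measurable_funM.
- by apply/measurable_EFinP; apply: measurable_funM.
- move=> x Dx; rewrite -EFinM lee_fin normrM (ger0_norm (k0 _ Dx)) mulrC.
  by rewrite ler_wpM2r ?k0 ?fM.
Qed.

Lemma measurable_power_kernel gam : measurable_fun setT
  (fun z : measurableTypeR R * measurableTypeR R => (z.1 - z.2) `^ (- gam)).
Proof.
by apply: (measurableT_comp (measurable_powR _)); exact: measurable_funB.
Qed.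

(** Multiplying the kernel at b by the bounded function (b - t)^gam gives back f. With f = y', this
    extracts integrability of y' from membership in [frac_space]. *)
Lemma integrable_of_left_kernel a b gam f : a < b -> 0 < gam ->
  mu.-integrable `]a, b[ (EFin \o left_kernel gam f b) ->
  mu.-integrable `]a, b[ (EFin \o f).
Proof.
move=> ab gam0 ik.
have mp : measurable_fun (`]a, b[ : set (measurableTypeR R))
    (fun t => (b - t) `^ gam).
  apply: (measurableT_comp (measurable_powR _)).
  by apply: measurable_funB => //; exact: measurable_cst.
have bp : [bounded ((b - t) `^ gam) | t in (`]a, b[ : set (measurableTypeR R))].
  exists ((b - a) `^ gam); split; first exact: ger0_real (powR_ge0 _ _).
  move=> M ltM t /=; rewrite in_itv/= => /andP[at_ tb].
  rewrite ger0_norm ?powR_ge0// (le_trans _ (ltW ltM))//.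
  by apply: ge0_ler_powR; rewrite ?nnegrE ?(ltW gam0)//; lra.
have := integrableMl _ ik mp bp; move=> /(_ (measurable_itv _)).
apply: eq_integrable => //.
move=> t; rewrite inE/= in_itv/= => /andP[_ tb].
rewrite /left_kernel /= -EFinM mulrAC powRN mulVf ?mul1r//.
by rewrite gt_eqF//; apply: powR_gt0; rewrite subr_gt0.
Qed.

(** Fubini moves the kernel from y' to f, producing Phi; [abs_continuous_IBP] then moves the
    derivative from y to Phi. The boundary term depends on y only through its end values. *)
Lemma caputo_left_IBP a b gam f y : a < b -> 0 < gam -> gam < 1 ->
  {within `[a, b], continuous f} -> has_continuous_RL_right a b gam f ->
  abs_continuous a b y ->
  (forall x, x \in `]a, b] ->
    mu.-integrable `]a, x[ (EFin \o left_kernel gam (derive1 y) x)) ->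
  {within `[a, b], continuous (caputo_left a gam y)} ->
  let Phi z := \int[mu]_(t in `]z, b[) right_kernel gam f z t in
  \int[mu]_(x in `]a, b[) (f x * caputo_left a gam y x) =
  (Gamma (1 - gam))^-1 * (Phi b * y b - Phi a * y a) +
  \int[mu]_(x in `]a, b[) (y x * RL_right a b gam f x).
Proof.
move=> ab gam0 gam1 cf [kf dPhi cRL] acy ky ccap Phi; have ab' := ltW ab.
have iy' : mu.-integrable `]a, b[ (EFin \o derive1 y).
  apply: (integrable_of_left_kernel ab gam0); apply: ky.
  by rewrite in_itv/= ab lexx.
have cy := abs_continuous_continuous acy.
pose G := (Gamma (1 - gam))^-1.
pose inner x := \int[mu]_(t in `]a, x[) left_kernel gam (derive1 y) x t.
have capE x : x \in `]a, b[ -> caputo_left a gam y x = G * inner x.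
  by rewrite in_itv/= => /andP[ax _]; rewrite /caputo_left gt_eqF.
have RLE x : RL_right a b gam f x = - G * derive_within `[a, b] Phi x by [].
have LE : \int[mu]_(x in `]a, b[) (f x * caputo_left a gam y x) =
    \int[mu]_(x in `]a, b[) (G * (f x * inner x)).
  by apply: eq_Rintegral => x; rewrite inE/= => /capE ->; rewrite mulrCA.
have RE : \int[mu]_(x in `]a, b[) (y x * RL_right a b gam f x) =
    \int[mu]_(x in `]a, b[) (- G * (y x * derive_within `[a, b] Phi x)).
  by apply: eq_Rintegral => x _; rewrite RLE mulrCA.
rewrite LE RE -/G.
(* G = 0 only if Gamma (1 - gam) = 0, as 0^-1 = 0; positivity of Gamma is not
   needed because both sides then vanish. *)
have [G0|G0] := eqVneq G 0.
  rewrite G0 mul0r add0r; apply: eq_Rintegral => x _.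
  by rewrite oppr0 !mul0r.
(* The continuity assumed for the Riemann-Liouville derivative passes to the derivative of Phi on
   dividing by -G. *)
have cphi : {within `[a, b], continuous (derive_within `[a, b] Phi)}.
  have -> : derive_within `[a, b] Phi = (fun x => - G^-1 * RL_right a b gam f x).
    by apply/funext => x; rewrite RLE mulrA mulrNN mulVf// mul1r.
  by apply: continuous_itvM => // x; exact: cvg_cst.
rewrite RintegralZl_neq0//; last first.
  have := continuous_itv_integrable (lexx a) (lexx b) (continuous_itvM cf ccap).
  apply: eq_integrable => // x; rewrite inE/= => /capE ->.
  by rewrite mulrCA.
rewrite (RintegralZl_neq0 (c := - G)) ?oppr_eq0//; last first.
  have := continuous_itv_integrable (lexx a) (lexx b) (continuous_itvM cy cRL).
  by apply: eq_integrable => // x _ /=; rewrite RLE mulrCA.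
rewrite mulNr -mulrBr; congr (G * _).
rewrite -(abs_continuous_IBP ab acy iy' dPhi cphi).
have [M M0 fM] := continuous_itv_bounded cf.
(* M bounds |f| and the other factor bounds the kernel integral over ]t, b[, with b - t enlarged to
   b - a so that the constant does not depend on t. *)
apply: (@triangle_Fubini_right R a b (fun z => (z.1 - z.2) `^ (- gam)) f (derive1 y)
  _ _ _ _ _ (M * ((1 - gam)^-1 * (b - a) `^ (1 - gam)))).
- exact: measurable_power_kernel.
- apply/measurable_EFinP; apply: (measurable_int mu).
  exact: continuous_itv_integrable cf.
- by apply/measurable_EFinP; exact: (measurable_int mu).
- by move=> x xab; apply: ky; exact: subset_itv_oo_oc.
- by move=> t tab; apply: kf; exact: subset_itv_oo_cc.
- exact: iy'.
- move=> t; rewrite in_itv/= => /andP[at_ tb].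
  apply: bounded_kernel_integral_le => //.
  + apply: (measurableT_comp (measurable_powR _)).
    by apply: measurable_funB => //; exact: measurable_cst.
  + apply/measurable_EFinP; apply: (measurable_int mu).
    by apply: continuous_itv_integrable cf => //; exact: ltW.
  + by move=> x _; exact: powR_ge0.
  + move=> x /=; rewrite in_itv/= => /andP[tx xb].
    by apply: fM; rewrite in_itv/= !ltW// (lt_trans at_).
  + apply: (le_trans (integral_power_right_le gam1 tb)).
    rewrite lee_fin ler_wpM2l ?invr_ge0 ?subr_ge0 ?(ltW gam1)//.
    by apply: ge0_ler_powR; rewrite ?nnegrE ?subr_ge0 ?(ltW gam1)//; lra.
Qed.

(** Mirror image of the left case, with the signs exchanged. Fubini is read backwards: y' is now the
    function of the outer variable x, and the uniform bound comes from integrating in t. *)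
Lemma caputo_right_IBP a b gam f y : a < b -> 0 < gam -> gam < 1 ->
  {within `[a, b], continuous f} -> has_continuous_RL_left a b gam f ->
  abs_continuous a b y -> mu.-integrable `]a, b[ (EFin \o derive1 y) ->
  (forall x, x \in `[a, b[ ->
    mu.-integrable `]x, b[ (EFin \o right_kernel gam (derive1 y) x)) ->
  {within `[a, b], continuous (caputo_right b gam y)} ->
  let Psi z := \int[mu]_(t in `]a, z[) left_kernel gam f z t in
  \int[mu]_(x in `]a, b[) (f x * caputo_right b gam y x) =
  - (Gamma (1 - gam))^-1 * (Psi b * y b - Psi a * y a) +
  \int[mu]_(x in `]a, b[) (y x * RL_left a b gam f x).
Proof.
move=> ab gam0 gam1 cf [kf dPsi cRL] acy iy' ky ccap Psi; have ab' := ltW ab.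
have cy := abs_continuous_continuous acy.
pose G := (Gamma (1 - gam))^-1.
pose inner x := \int[mu]_(t in `]x, b[) right_kernel gam (derive1 y) x t.
have capE x : x \in `]a, b[ -> caputo_right b gam y x = - G * inner x.
  by rewrite in_itv/= => /andP[_ xb]; rewrite /caputo_right lt_eqF.
have RLE x : RL_left a b gam f x = G * derive_within `[a, b] Psi x by [].
have LE : \int[mu]_(x in `]a, b[) (f x * caputo_right b gam y x) =
    \int[mu]_(x in `]a, b[) (- G * (f x * inner x)).
  by apply: eq_Rintegral => x; rewrite inE/= => /capE ->; rewrite mulrCA.
have RE : \int[mu]_(x in `]a, b[) (y x * RL_left a b gam f x) =
    \int[mu]_(x in `]a, b[) (G * (y x * derive_within `[a, b] Psi x)).
  by apply: eq_Rintegral => x _; rewrite RLE mulrCA.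
rewrite LE RE -/G.
have [G0|G0] := eqVneq G 0.
  rewrite G0 oppr0 mul0r add0r; apply: eq_Rintegral => x _.
  by rewrite !mul0r.
have cpsi : {within `[a, b], continuous (derive_within `[a, b] Psi)}.
  have -> : derive_within `[a, b] Psi = (fun x => G^-1 * RL_left a b gam f x).
    by apply/funext => x; rewrite RLE mulKf.
  by apply: continuous_itvM => // x; exact: cvg_cst.
rewrite (RintegralZl_neq0 (c := - G)) ?oppr_eq0//; last first.
  have := continuous_itv_integrable (lexx a) (lexx b) (continuous_itvM cf ccap).
  apply: eq_integrable => // x; rewrite inE/= => /capE ->.
  by rewrite mulrCA.
rewrite (RintegralZl_neq0 (c := G))//; last first.
  have := continuous_itv_integrable (lexx a) (lexx b) (continuous_itvM cy cRL).
  by apply: eq_integrable => // x _ /=; rewrite RLE mulrCA.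
rewrite -[X in _ = _ + X]mulrNN -mulrDr; congr (- G * _).
rewrite -(abs_continuous_IBP ab acy iy' dPsi cpsi).
have [M M0 fM] := continuous_itv_bounded cf.
apply/esym.
apply: (@triangle_Fubini_left R a b (fun z => (z.1 - z.2) `^ (- gam)) (derive1 y) f
  _ _ _ _ _ (M * ((1 - gam)^-1 * (b - a) `^ (1 - gam)))).
- exact: measurable_power_kernel.
- by apply/measurable_EFinP; exact: (measurable_int mu).
- apply/measurable_EFinP; apply: (measurable_int mu).
  exact: continuous_itv_integrable cf.
- by move=> x xab; apply: kf; exact: subset_itv_oo_cc.
- by move=> t tab; apply: ky; exact: subset_itv_oo_co.
- exact: iy'.
- move=> x; rewrite in_itv/= => /andP[ax xb].
  apply: bounded_kernel_integral_le => //.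
  + apply: (measurableT_comp (measurable_powR _)).
    by apply: measurable_funB => //; exact: measurable_cst.
  + apply/measurable_EFinP; apply: (measurable_int mu).
    by apply: continuous_itv_integrable cf => //; exact: ltW.
  + by move=> t _; exact: powR_ge0.
  + move=> t /=; rewrite in_itv/= => /andP[at_ tx].
    by apply: fM; rewrite in_itv/= !ltW// (lt_trans tx).
  + apply: (le_trans (integral_power_left_le gam1 ax)).
    rewrite lee_fin ler_wpM2l ?invr_ge0 ?subr_ge0 ?(ltW gam1)//.
    by apply: ge0_ler_powR; rewrite ?nnegrE ?subr_ge0 ?(ltW gam1)//; lra.
Qed.

End FractionalIBP.

(** * The first variation and convexity *)

Section RiemannLiouvilleLinearity.
Variable R : realType.
Local Notation mu := (@lebesgue_measure R).
Implicit Types (a b x t gam : R) (f g h y : R -> R).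

Lemma within_continuous_eq a b f g : (forall x, x \in `[a, b] -> f x = g x) ->
  {within `[a, b], continuous f} -> {within `[a, b], continuous g}.
Proof.
move=> fg /subspace_continuousP cf; apply/subspace_continuousP => x xab.
have cfx : f z @[z --> within `[a, b]%classic (nbhs x)] --> f x := cf _ xab.
suff : g z @[z --> within `[a, b]%classic (nbhs x)] --> g x by [].
rewrite -(fg _ xab); apply: cvg_trans cfx; apply: near_eq_cvg.
by rewrite near_withinE; near=> z => zab; rewrite fg.
Unshelve. all: by end_near. Qed.

Lemma continuous_itvDZ a b f g (l : R) : {within `[a, b], continuous f} ->
  {within `[a, b], continuous g} ->
  {within `[a, b], continuous (fun x => f x + l * g x)}.
Proof.
move=> cf cg x; apply: cvgD; first exact: cf.
by apply: cvgM; [exact: cvg_cst|exact: cg].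
Qed.

Lemma RintegralDZ_eq (D : set (measurableTypeR R))
    (f g h : measurableTypeR R -> R) (l : R) :
  measurable D -> (forall t, D t -> h t = f t + l * g t) ->
  mu.-integrable D (EFin \o f) -> mu.-integrable D (EFin \o g) ->
  mu.-integrable D (EFin \o h) /\
  \int[mu]_(t in D) h t = \int[mu]_(t in D) f t + l * \int[mu]_(t in D) g t.
Proof.
move=> mD hE if_ ig; have ilg := integrableZl mD l ig.
split.
  apply: eq_integrable (integrableD mD if_ ilg) => // t; rewrite inE => Dt.
  by rewrite /= hE.
rewrite -RintegralZl// -RintegralD//.
by apply: eq_Rintegral => t; rewrite inE => Dt; rewrite hE.
Qed.

Lemma RintegralB_eq (D : set (measurableTypeR R))
    (f g : measurableTypeR R -> R) (c : R) :
  measurable D -> mu.-integrable D (EFin \o f) -> mu.-integrable D (EFin \o g) ->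
  \int[mu]_(t in D) f t = c + \int[mu]_(t in D) g t ->
  \int[mu]_(t in D) (f t - g t) = c.
Proof. by move=> mD if_ ig fE; rewrite RintegralB// fE addrK. Qed.

(** Transfers regularity from the partial derivatives of L and g to those of F. The identity for h
    is required on [a, b] only, since the partial derivatives are known to combine linearly only
    over the slab. *)
Lemma has_continuous_RL_rightDZ a b gam f g h (l : R) : a < b ->
  (forall x, x \in `[a, b] -> h x = f x + l * g x) ->
  has_continuous_RL_right a b gam f -> has_continuous_RL_right a b gam g ->
  has_continuous_RL_right a b gam h.
Proof.
move=> ab hE [kf df cf] [kg dg cg].
have kh x : x \in `[a, b] ->
    mu.-integrable `]x, b[ (EFin \o right_kernel gam h x) /\
    \int[mu]_(t in `]x, b[) right_kernel gam h x t =
    \int[mu]_(t in `]x, b[) right_kernel gam f x t +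
    l * \int[mu]_(t in `]x, b[) right_kernel gam g x t.
  move=> xab; apply: (RintegralDZ_eq _ _ (kf x xab) (kg x xab)).
    exact: measurable_itv.
  move=> t /= txb; rewrite /right_kernel hE; first by ring.
  move: xab txb; rewrite !in_itv/= => /andP[ax _] /andP[xt tb].
  by rewrite (ltW tb) andbT ltW// (le_lt_trans ax).
have dh x : x \in `[a, b] -> _ := fun xab => derive_withinDZ ab xab
  (fun z zab => (kh z zab).2) (df x xab) (dg x xab).
split; first by move=> x /kh[].
- by move=> x /dh[].
- apply: within_continuous_eq (continuous_itvDZ (l := l) cf cg) => x xab.
  by rewrite /RL_right (dh _ xab).2; ring.
Qed.

Lemma has_continuous_RL_leftDZ a b gam f g h (l : R) : a < b ->
  (forall x, x \in `[a, b] -> h x = f x + l * g x) ->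
  has_continuous_RL_left a b gam f -> has_continuous_RL_left a b gam g ->
  has_continuous_RL_left a b gam h.
Proof.
move=> ab hE [kf df cf] [kg dg cg].
have kh x : x \in `[a, b] ->
    mu.-integrable `]a, x[ (EFin \o left_kernel gam h x) /\
    \int[mu]_(t in `]a, x[) left_kernel gam h x t =
    \int[mu]_(t in `]a, x[) left_kernel gam f x t +
    l * \int[mu]_(t in `]a, x[) left_kernel gam g x t.
  move=> xab; apply: (RintegralDZ_eq _ _ (kf x xab) (kg x xab)).
    exact: measurable_itv.
  move=> t /= txb; rewrite /left_kernel hE; first by ring.
  move: xab txb; rewrite !in_itv/= => /andP[_ xb] /andP[at_ tx].
  by rewrite (ltW at_)/= ltW// (lt_le_trans tx).
have dh x : x \in `[a, b] -> _ := fun xab => derive_withinDZ ab xab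
  (fun z zab => (kh z zab).2) (df x xab) (dg x xab).
split; first by move=> x /kh[].
- by move=> x /dh[].
- apply: within_continuous_eq (continuous_itvDZ (l := l) cf cg) => x xab.
  by rewrite /RL_left (dh _ xab).2; ring.
Qed.

End RiemannLiouvilleLinearity.

(** * First variation under the Euler-Lagrange equation *)

Section EulerLagrange.
Variable R : realType.
Local Notation mu := (@lebesgue_measure R).
Variables (a b alpha beta : R).
Hypotheses (ab : a < b) (alpha0 : 0 < alpha) (alpha1 : alpha < 1).
Hypotheses (beta0 : 0 < beta) (beta1 : beta < 1).
Implicit Types (f y : R -> R).

Definition first_variation f2 f3 f4 y :=
  \int[mu]_(x in `]a, b[) (f2 x * y x + f3 x * caputo_left a alpha y x
    + f4 x * caputo_right b beta y x).

(** The first variation is evaluated at y and at y0 separately instead of at y - y0, which avoids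
    appealing to linearity of the Caputo derivatives. Each value reduces to boundary terms, and
    these agree because the end values do. *)
Lemma first_variation_boundary f2 f3 f4 y y0 :
  {within `[a, b], continuous f3} -> {within `[a, b], continuous f4} ->
  has_continuous_RL_right a b alpha f3 -> has_continuous_RL_left a b beta f4 ->
  (forall x, x \in `[a, b] ->
    f2 x + RL_right a b alpha f3 x + RL_left a b beta f4 x = 0) ->
  frac_space a b alpha beta y -> frac_space a b alpha beta y0 ->
  y a = y0 a -> y b = y0 b ->
  first_variation f2 f3 f4 y = first_variation f2 f3 f4 y0.
Proof.
move=> c3 c4 RL3 RL4 EL Ey Ey0 yya yyb.
suff fvE z : frac_space a b alpha beta z -> first_variation f2 f3 f4 z =
    (Gamma (1 - alpha))^-1 *
      ((\int[mu]_(t in `]b, b[) right_kernel alpha f3 b t) * z b -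
       (\int[mu]_(t in `]a, b[) right_kernel alpha f3 a t) * z a) +
    - (Gamma (1 - beta))^-1 *
      ((\int[mu]_(t in `]a, b[) left_kernel beta f4 b t) * z b -
       (\int[mu]_(t in `]a, a[) left_kernel beta f4 a t) * z a).
  by rewrite (fvE _ Ey) (fvE _ Ey0) yya yyb.
move=> [acz kl kr ccl ccr].
have cz := abs_continuous_continuous acz.
have iz' : mu.-integrable `]a, b[ (EFin \o derive1 z).
  apply: (integrable_of_left_kernel ab alpha0).
  by apply: kl; rewrite in_itv/= ab lexx.
have IL := caputo_left_IBP ab alpha0 alpha1 c3 RL3 acz kl ccl.
have IR := caputo_right_IBP ab beta0 beta1 c4 RL4 acz iz' kr ccr.
have [_ _ cRL3] := RL3; have [_ _ cRL4] := RL4.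
have int f : {within `[a, b], continuous f} -> mu.-integrable `]a, b[ (EFin \o f).
  exact: continuous_itv_integrable.
have i1 := int _ (continuous_itvM cz cRL3).
have i2 := int _ (continuous_itvM cz cRL4).
have i3 := int _ (continuous_itvM c3 ccl).
have i4 := int _ (continuous_itvM c4 ccr).
have mI : measurable (`]a, b[ : set (measurableTypeR R)) by exact: measurable_itv.
(* The Euler-Lagrange equation eliminates f2; each of the two remaining differences integrates to a
   boundary term of fractional integration by parts. *)
transitivity (\int[mu]_(x in `]a, b[)
  ((f3 x * caputo_left a alpha z x - z x * RL_right a b alpha f3 x)
  + (f4 x * caputo_right b beta z x - z x * RL_left a b beta f4 x))).
  apply: eq_Rintegral => x; rewrite inE/= => /subset_itv_oo_cc/EL h.
  have -> : f2 x = - RL_right a b alpha f3 x - RL_left a b beta f4 x by lra.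
  by ring.
rewrite RintegralD//; last 2 first.
- by have := integrableB mI i3 i1; exact: eq_integrable.
- by have := integrableB mI i4 i2; exact: eq_integrable.
congr (_ + _).
- exact: (RintegralB_eq mI i3 i1 IL).
- exact: (RintegralB_eq mI i4 i2 IR).
Qed.

End EulerLagrange.

(** * Convexity of F and continuity along curves *)

Section ConvexLagrangian.
Variable R : realType.
Local Notation mu := (@lebesgue_measure R).
Implicit Types (a b x l : R) (y u v : R -> R) (f g : R * R * R * R -> R).

Lemma derive1DZ (f g : R -> R) l x : derivable f x 1 -> derivable g x 1 ->
  derive1 (fun s => f s + l * g s) x = derive1 f x + l * derive1 g x.
Proof.
move=> /derivableP df /derivableP dg.
by have [_] := is_deriveD df (is_deriveZ l dg); rewrite !derive1E.
Qed.

Lemma derive1Z (g : R -> R) l x : derivable g x 1 ->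
  derive1 (fun s => l * g s) x = l * derive1 g x.
Proof.
by move=> /derivableP dg; have [_] := is_deriveZ l dg; rewrite !derive1E.
Qed.

Lemma partialsDZ (S : set (R * R * R * R)) f g l p : S p ->
  has_continuous_partials234 S f -> has_continuous_partials234 S g ->
  [/\ partial2 (fun q => f q + l * g q) p = partial2 f p + l * partial2 g p,
      partial3 (fun q => f q + l * g q) p = partial3 f p + l * partial3 g p &
      partial4 (fun q => f q + l * g q) p = partial4 f p + l * partial4 g p].
Proof.
case: p => [[[x y] u] v] Sp [/(_ _ Sp)[/= f2 f3 f4] _ _ _].
move=> [/(_ _ Sp)[/= g2 g3 g4] _ _ _].
by split; [exact: (derive1DZ l f2 g2)|exact: (derive1DZ l f3 g3)|
  exact: (derive1DZ l f4 g4)].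
Qed.

Lemma partialsZ (S : set (R * R * R * R)) g l p : S p ->
  has_continuous_partials234 S g ->
  [/\ partial2 (fun q => l * g q) p = l * partial2 g p,
      partial3 (fun q => l * g q) p = l * partial3 g p &
      partial4 (fun q => l * g q) p = l * partial4 g p].
Proof.
case: p => [[[x y] u] v] Sp [/(_ _ Sp)[/= g2 g3 g4] _ _ _].
by split; [exact: (derive1Z l g2)|exact: (derive1Z l g3)|
  exact: (derive1Z l g4)].
Qed.

(** The sum of the gradient inequalities of f and l g, with increments y' - y, u' - u, v' - v.
    Differentiability of g is a separate hypothesis because that of l g says nothing about g when l
    = 0. The terms are arranged as sums so that the first variations at y and y0 appear on opposite
    sides. *)
Lemma convex_sum_gradient_le (S : set (R * R * R * R)) f g l
    (x y u v y' u' v' : R) :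
  has_continuous_partials234 S g ->
  convex_in S f -> convex_in S (fun p => l * g p) ->
  S (x, y, u, v) -> S (x, y', u', v') ->
  let F := fun p => f p + l * g p in
  let p := (x, y, u, v) in
  is_true (partial2 F p * y' + partial3 F p * u' + partial4 F p * v' + F p <=
    F (x, y', u', v') + (partial2 F p * y + partial3 F p * u + partial4 F p * v)).
Proof.
move=> pg [pf cf] [_ cg] Sp Sp' F p.
have [-> -> ->] := partialsDZ l Sp pf pg.
have [g2 g3 g4] := partialsZ l Sp pg.
have := cf x y u v (y' - y) (u' - u) (v' - v) Sp.
have := cg x y u v (y' - y) (u' - u) (v' - v) Sp.
have shift (s t : R) : s + (t - s) = t by ring.
rewrite !shift => /(_ Sp') hg /(_ Sp').
move: hg; rewrite g2 g3 g4 /F -/p.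
move: (partial2 f p) (partial3 f p) (partial4 f p) (partial2 g p)
  (partial3 g p) (partial4 g p) (f p) (g p) (f _) (g _) => *.
by lra.
Qed.

Lemma RintegralD_le (D : set (measurableTypeR R))
    (f1 f2 g1 g2 : measurableTypeR R -> R) :
  measurable D ->
  mu.-integrable D (EFin \o f1) -> mu.-integrable D (EFin \o f2) ->
  mu.-integrable D (EFin \o g1) -> mu.-integrable D (EFin \o g2) ->
  (forall x, D x -> f1 x + f2 x <= g1 x + g2 x) ->
  \int[mu]_(x in D) f1 x + \int[mu]_(x in D) f2 x <=
  \int[mu]_(x in D) g1 x + \int[mu]_(x in D) g2 x.
Proof.
move=> mD i1 i2 j1 j2 fg; rewrite -!RintegralD//; apply: le_Rintegral => //.
  exact: (integrableD mD i1 i2).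
exact: (integrableD mD j1 j2).
Qed.

(** The curve x |-> (x, y x, u x, v x) stays in the slab for x in [a, b], so relative continuity of
    f is enough. *)
Lemma continuous_slab_comp a b f y u v : {within slab a b, continuous f} ->
  {within `[a, b], continuous y} -> {within `[a, b], continuous u} ->
  {within `[a, b], continuous v} ->
  {within `[a, b], continuous (fun x => f (x, y x, u x, v x))}.
Proof.
move=> /subspace_continuousP cf /subspace_continuousP cy.
move=> /subspace_continuousP cu /subspace_continuousP cv.
apply/subspace_continuousP => x xab.
have cfx : f q @[q --> within (slab a b) (nbhs (x, y x, u x, v x))] -->
  f (x, y x, u x, v x) by apply: cf.
apply: cvg_trans cfx => U fU.
pose W := within `[a, b]%classic (nbhs x).
have cid : z @[z --> W] --> x by apply: cvg_within_filter; exact: cvg_id.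
have cy' : y z @[z --> W] --> y x := cy _ xab.
have cu' : u z @[z --> W] --> u x := cu _ xab.
have cv' : v z @[z --> W] --> v x := cv _ xab.
have cp : (z, y z, u z, v z) @[z --> W] --> (x, y x, u x, v x).
  exact: (cvg_pair (cvg_pair (cvg_pair cid cy') cu') cv').
suff : \forall z \near W, U (f (z, y z, u z, v z)) by [].
have {}fU : \forall q \near (x, y x, u x, v x), slab a b q -> U (f q) by exact: fU.
near=> z.
have : slab a b (z, y z, u z, v z) -> U (f (z, y z, u z, v z)).
  by near: z; exact: (cp _ fU).
by apply; near: z; exact: withinT.
Unshelve. all: by end_near. Qed.

Lemma Rintegral_itv_ccoo a b (h : R -> R) : {within `[a, b], continuous h} ->
  \int[mu]_(x in `[a, b]) h x = \int[mu]_(x in `]a, b[) h x.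
Proof.
move=> ch; rewrite /Rintegral (@integral_itv_bndoo _ _ _ _ true false)//.
apply: (measurable_int mu).
exact: (continuous_itv_integrable (lexx a) (lexx b) ch).
Qed.

End ConvexLagrangian.

(** * Sufficiency of the Euler-Lagrange equation for the constrained minimum *)

Theorem theorem3p10 (R : realType) (a b alpha beta l lambda : R)
    (L g : R * R * R * R -> R) (y0 : R -> R) :
  let E := frac_space a b alpha beta in
  let br := jet a b alpha beta in
  let F := fun p => L p + lambda * g p in
  let J := fun y : R -> R => \int[lebesgue_measure]_(x in `[a, b]) L (br y x) in
  let I := fun y : R -> R => \int[lebesgue_measure]_(x in `[a, b]) g (br y x) in
  a < b ->
  0 < alpha -> alpha < 1 ->
  0 < beta -> beta < 1 ->
  C1_slab a b L ->
  C1_slab a b g ->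
  convex_in (slab a b) L ->
  convex_in (slab a b) (fun p => lambda * g p) ->
  E y0 ->
  has_continuous_RL_right a b alpha (fun x => partial3 L (br y0 x)) ->
  has_continuous_RL_right a b alpha (fun x => partial3 g (br y0 x)) ->
  has_continuous_RL_left a b beta (fun x => partial4 L (br y0 x)) ->
  has_continuous_RL_left a b beta (fun x => partial4 g (br y0 x)) ->
  (forall x, x \in `[a, b] ->
     partial2 F (br y0 x)
     + RL_right a b alpha (fun z => partial3 F (br y0 z)) x
     + RL_left a b beta (fun z => partial4 F (br y0 z)) x = 0) ->
  I y0 = l ->
  minimizes J
    [set y | [/\ E y, y a = y0 a, y b = y0 b & I y = l]] y0.
Proof.
(* A and B will be the first variations at y and y0, P and Q the integrals of F along y0 and y, and
   C and D the values J y0 and J y. *)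
have cancel (A B C D P Q : R) : A = B -> P = C + lambda * l ->
    Q = D + lambda * l -> A + P <= Q + B -> C <= D.
  by move=> -> -> -> h; lra.
move=> E br F J I ab al0 al1 be0 be1 [cL _ _ pL] [cg _ _ pg] convL convg.
move=> Ey0 RL3L RL3g RL4L RL4g EL Iy0.
split; first by split.
move=> y [Ey ya yb Iy]; have ab' := ltW ab.
have brS z x : x \in `[a, b] -> slab a b (br z x) by [].
have cE z : E z -> [/\ {within `[a, b], continuous z},
    {within `[a, b], continuous (caputo_left a alpha z)} &
    {within `[a, b], continuous (caputo_right b beta z)}].
  by move=> [/abs_continuous_continuous].
have cbr (f : R * R * R * R -> R) z : E z -> {within slab a b, continuous f} ->
    {within `[a, b], continuous (fun x => f (br z x))}.
  by move=> /cE[cz czl czr] cf; exact: continuous_slab_comp.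
have pFE x : x \in `[a, b] -> _ := fun xab => partialsDZ lambda (brS y0 x xab) pL pg.
have p2E x : x \in `[a, b] -> partial2 F (br y0 x) =
    partial2 L (br y0 x) + lambda * partial2 g (br y0 x) by case/pFE.
have p3E x : x \in `[a, b] -> partial3 F (br y0 x) =
    partial3 L (br y0 x) + lambda * partial3 g (br y0 x) by case/pFE.
have p4E x : x \in `[a, b] -> partial4 F (br y0 x) =
    partial4 L (br y0 x) + lambda * partial4 g (br y0 x) by case/pFE.
have [_ cL2 cL3 cL4] := pL; have [_ cg2 cg3 cg4] := pg.
have cFi (fL fg fF : R * R * R * R -> R) : {within slab a b, continuous fL} ->
    {within slab a b, continuous fg} ->
    (forall x, x \in `[a, b] ->
      fF (br y0 x) = fL (br y0 x) + lambda * fg (br y0 x)) ->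
    {within `[a, b], continuous (fun x => fF (br y0 x))}.
  move=> cfL cfg fFE; apply: (@within_continuous_eq _ _ _
    (fun x => fL (br y0 x) + lambda * fg (br y0 x))); first by move=> x /fFE ->.
  by apply: continuous_itvDZ; exact: cbr.
have c2 := cFi _ _ _ cL2 cg2 p2E.
have c3 := cFi _ _ _ cL3 cg3 p3E.
have c4 := cFi _ _ _ cL4 cg4 p4E.
have RL3 := has_continuous_RL_rightDZ ab p3E RL3L RL3g.
have RL4 := has_continuous_RL_leftDZ ab p4E RL4L RL4g.
pose V z x := partial2 F (br y0 x) * z x
  + partial3 F (br y0 x) * caputo_left a alpha z x
  + partial4 F (br y0 x) * caputo_right b beta z x.
have VE : \int[lebesgue_measure]_(x in `]a, b[) V y x =
    \int[lebesgue_measure]_(x in `]a, b[) V y0 x.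
  exact: (first_variation_boundary ab al0 al1 be0 be1 c3 c4 RL3 RL4 EL Ey Ey0 ya yb).
have cV z : E z -> {within `[a, b], continuous (V z)}.
  move=> /cE[cz czl czr] x; apply: cvgD; last exact: (continuous_itvM c4 czr).
  by apply: cvgD; [exact: (continuous_itvM c2 cz)|exact: (continuous_itvM c3 czl)].
have cF z : E z -> {within `[a, b], continuous (fun x => F (br z x))}.
  by move=> Ez; apply: continuous_itvDZ; exact: cbr.
have ptwise x : x \in `[a, b] -> V y x + F (br y0 x) <= F (br y x) + V y0 x.
  by move=> xab; apply: (convex_sum_gradient_le pg convL convg).
have iE h : {within `[a, b], continuous h} ->
    lebesgue_measure.-integrable `]a, b[ (EFin \o h).
  exact: continuous_itv_integrable.
have mI : measurable (`]a, b[ : set (measurableTypeR R)) by exact: measurable_itv.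
have main := RintegralD_le mI (iE _ (cV y Ey)) (iE _ (cF y0 Ey0))
  (iE _ (cF y Ey)) (iE _ (cV y0 Ey0)) (fun x xab => ptwise x (subset_itv_oo_cc xab)).
(* The isoperimetric constraint enters here: the integrals of F and L differ by the same constant
   lambda l for all admissible functions. *)
have FE z : E z -> I z = l ->
    \int[lebesgue_measure]_(x in `]a, b[) F (br z x) = J z + lambda * l.
  move=> Ez <-; have cLz := cbr L z Ez cL; have cgz := cbr g z Ez cg.
  have := RintegralDZ_eq mI (fun x _ => erefl (F (br z x)))
    (iE _ cLz) (iE _ cgz).
  by rewrite -(Rintegral_itv_ccoo cLz) -(Rintegral_itv_ccoo cgz) => -[].
exact: (cancel _ _ _ _ _ _ VE (FE _ Ey0 Iy0) (FE _ Ey Iy) main).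
Qed.
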